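(* Let $m\ge 1$, let $H, H_1,\dots,H_m$ be (real) Hilbert spaces of finite, positive dimensions, for each $1\le j\le m$ let $\ell_j:H\to H_j$ be a surjective linear transformation, and let $p_j\in[1,\infty]$. Then $$\sup_{f_1,\dots,f_m}\ \frac{\int_H \prod_{j=1}^m f_j(\ell_j(y))\,dy}{\prod_{j=1}^m \|f_j\|_{L^{p_j}(H_j)}}<\infty,$$ where the supremum is taken over all $m$-tuples of nonnegative Lebesgue measurable functions $f_j:H_j\to[0,+\infty]$ having positive, finite $L^{p_j}(H_j)$ norms, if and only if both $$\dim(H)=\sum_{j=1}^m p_j^{-1}\dim(H_j)$$ and $$\dim(V)\le\sum_{j=1}^m p_j^{-1}\dim(\ell_j(V))\quad\text{for every linear subspace } V\subset H.$$
   Context: Each finite-dimensional Hilbert space is equipped with its canonical Lebesgue measure, obtained by choosing an orthonormal basis and identifying the space with $\mathbb{R}^{d}$, $d$ its dimension. The convention $\infty^{-1}=0$ is used. *)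

(* Defs.v *)
From HB Require Import structures.
From mathcomp Require Import all_boot all_order all_algebra.
From mathcomp Require Import all_classical all_reals all_analysis.
From mathcomp Require Import measurable_realfun.
Import Order.TTheory GRing.Theory Num.Theory.
Import numFieldNormedType.Exports.

Set Implicit Arguments.
Unset Strict Implicit.
Unset Printing Implicit Defensive.

Local Open Scope classical_set_scope.
Local Open Scope ring_scope.

(* A real inner product on a finite-dimensional real vector space; completeness
   is automatic in finite dimension. *)
HB.mixin Record hasInner (R : realType) H of Vector R H := {
  inner : {dot H for @idfun R}
}.

#[short(type="hilbertType")]
HB.structure Definition Hilbert (R : realType) :=
  { H of hasInner R H & Vector R H }.

Arguments inner {R s}.

Section OrthonormalBasis.
Context {R : realType} (H : hilbertType R).
Local Notation n := (\dim {:H}).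

Lemma orthonormal_extend (s : seq H) : (size s < n)%N ->
  orthonormal (@inner R H) s -> exists x, orthonormal (@inner R H) (x :: s).
Proof.
move=> sn os.
pose g (v : H) : 'rV[R]_(size s) := \row_i inner v s`_i.
have lg : linear g.
  by move=> a u v; apply/rowP => i; rewrite !mxE linearDl/= linearZl_LR.
pose gL := GRing.isLinear.Build _ _ _ _ g lg.
pose g' : {linear H -> 'rV[R]_(size s)} := HB.pack g gL.
pose w := vpick (lker (linfun g')).
have w0 : w != 0.
  rewrite vpick0 -dimv_eq0; apply: contraTneq sn => k0.
  have := limg_ker_dim (linfun g') fullv; rewrite capfv k0 add0n => <-.
  by rewrite -leqNgt (leq_trans (dimvS (subvf _)))// dimvf /dim/= mul1n.
have ws x : x \in s -> inner w x = 0.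
  move=> xs; have := memv_pick (lker (linfun g')).
  rewrite memv_ker lfunE/= => /eqP/rowP.
  have xi : (index x s < size s)%N by rewrite index_mem.
  by move=> /(_ (Ordinal xi)); rewrite !mxE/= nth_index.
have wp : 0 < inner w w by exact: neq0_dnorm_gt0.
pose c := (Num.sqrt (inner w w))^-1.
have c2 : c * (c * inner w w) = 1.
  by rewrite mulrA -invfM -expr2 sqr_sqrtr ?(ltW wp)// mulVf// gt_eqF.
exists (c *: w); move: os => /andP[os1 os2]; rewrite /orthonormal /=.
rewrite linearZl_LR linearZr_LR/= c2 eqxx os1 os2 /= !andbT.
by apply/allP => x xs /=; rewrite linearZl_LR/= ws// mulr0.
Qed.

Lemma orthonormal_basis_exists :
  exists e : n.-tuple H, orthonormal (@inner R H) e.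
Proof.
suff h k : (k <= n)%N ->
    exists2 s : seq H, size s = k & orthonormal (@inner R H) s.
  by have [s /eqP sn os] := h n (leqnn _); exists (Tuple sn).
elim: k => [_|k IH kn]; first by exists [::].
have [s sk os] := IH (ltnW kn).
have [|x ox] := @orthonormal_extend s _ os; first by rewrite sk.
by exists (x :: s) => //=; rewrite sk.
Qed.

Definition onb : n.-tuple H := sval (cid orthonormal_basis_exists).

Definition onb_coord (x : H) : n.-tuple (measurableTypeR R) :=
  [tuple inner x (tnth onb i) | i < n].

End OrthonormalBasis.
Arguments onb_coord {R H}.

Section TupleLebesgue.
Context {R : realType}.
Local Open Scope ereal_scope.
Local Notation RB := (measurableTypeR R).

Definition tuple_cons n (xt : RB * n.-tuple RB) : n.+1.-tuple RB :=
  [tuple of xt.1 :: xt.2].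

Lemma measurable_tuple_cons n : measurable_fun setT (@tuple_cons n).
Proof. exact: measurable_cons. Qed.

Section TupleLebesgueS.
Context n (m : {sigma_finite_measure set (n.-tuple RB) -> \bar R}).

Definition tuple_lebesgueS : set (n.+1.-tuple RB) -> \bar R :=
  pushforward (lebesgue_measure \x m) (@tuple_cons n).

Let tuple_lebesgueS0 : tuple_lebesgueS set0 = 0.
Proof. by rewrite /tuple_lebesgueS /pushforward preimage_set0 measure0. Qed.

Let tuple_lebesgueS_ge0 A : 0 <= tuple_lebesgueS A.
Proof. exact: (measure_ge0 (lebesgue_measure \x m)). Qed.

Let tuple_lebesgueS_sigma_additive : semi_sigma_additive tuple_lebesgueS.
Proof.
move=> F mF tF mUF; rewrite /tuple_lebesgueS /pushforward preimage_bigcup.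
have mp A : measurable A -> measurable (@tuple_cons n @^-1` A).
  by move=> mA; rewrite -[X in measurable X]setTI; exact: measurable_tuple_cons.
apply: measure_semi_sigma_additive.
- by move=> i; exact: mp.
- apply/trivIsetP => /= i j _ _ ij; rewrite -preimage_setI.
  by move/trivIsetP : tF => /(_ _ _ _ _ ij) ->//; rewrite preimage_set0.
- by rewrite -preimage_bigcup; exact: mp.
Qed.

HB.instance Definition _ := isMeasure.Build _ _ _ tuple_lebesgueS
  tuple_lebesgueS0 tuple_lebesgueS_ge0 tuple_lebesgueS_sigma_additive.

(* The library's sigma-finite instance on [\x] is shadowed by the one for
   subprobabilities, so sigma-finiteness is reproved here. *)
Let tuple_lebesgueS_sigma_finite : sigma_finite setT tuple_lebesgueS.
Proof.
have /sigma_finiteP[F [TF ndF Foo]] := sigma_finiteT (@lebesgue_measure R).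
have /sigma_finiteP[G [TG ndG Goo]] := sigma_finiteT m.
have mth : measurable_fun setT (fun t : n.+1.-tuple RB => thead t).
  exact: measurable_tnth.
have mbe := @measurable_behead _ RB n.
exists (fun i => [set t : n.+1.-tuple RB |
    F i (thead t) /\ G i [tuple of behead t]]).
  apply/esym/seteqP; split => // t _.
  have [j _ Fj] : (\bigcup_i F i) (thead t) by rewrite -TF.
  have [k _ Gk] : (\bigcup_i G i) [tuple of behead t] by rewrite -TG.
  exists (maxn j k) => //; split.
  - by move: Fj; exact/subsetPset/ndF/leq_maxl.
  - by move: Gk; exact/subsetPset/ndG/leq_maxr.
move=> i; have [mF Fi] := Foo i; have [mG Gi] := Goo i; split.
  apply: measurableI; rewrite -[X in measurable X]setTI.
  - exact: mth.
  - exact: mbe.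
rewrite /tuple_lebesgueS /pushforward (_ : _ @^-1` _ = F i `*` G i).
  by rewrite product_measure1E// lte_mul_pinfty// ge0_fin_numE.
apply/seteqP; split => -[x t] [/= Fx Gt]; split => //=.
- by move: Gt; congr (G i _); exact/val_inj.
- by move: Gt; congr (G i _); exact/val_inj.
Qed.

HB.instance Definition _ := Measure_isSigmaFinite.Build _ _ _ tuple_lebesgueS
  tuple_lebesgueS_sigma_finite.

End TupleLebesgueS.

(* The n-fold product of the Lebesgue measure of R, on Borel sets. *)
Fixpoint tuple_lebesgue n : {sigma_finite_measure set (n.-tuple RB) -> \bar R} :=
  match n with
  | 0 => \d_([tuple])
  | k.+1 => tuple_lebesgueS (tuple_lebesgue k)
  end.
End TupleLebesgue.

Section HilbertLebesgue.
Context {R : realType} (H : hilbertType R).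
Local Open Scope ereal_scope.

(* Copy of H with the pointed structure required of measurable types. *)
Definition hilbert_pointed : Type := H.
HB.instance Definition _ := Choice.on hilbert_pointed.
HB.instance Definition _ := isPointed.Build hilbert_pointed (0%R : H).

(* Lebesgue outer measure of H, read in the coordinates of [onb H]; another
   orthonormal basis gives the same outer measure by orthogonal invariance. *)
Definition hilbert_outer (A : set hilbert_pointed) : \bar R :=
  ((tuple_lebesgue (\dim {:H}))^*)%mu (onb_coord @` (A : set H)).

Let hilbert_outer0 : hilbert_outer set0 = 0.
Proof. by rewrite /hilbert_outer image_set0 outer_measure0. Qed.

Let hilbert_outer_ge0 A : 0 <= hilbert_outer A.
Proof. exact: outer_measure_ge0. Qed.

Let le_hilbert_outer : {homo hilbert_outer : A B / A `<=` B >-> A <= B}.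
Proof. by move=> A B AB; apply: le_outer_measure; exact: image_subset. Qed.

Let hilbert_outer_sigma_subadditive : sigma_subadditive hilbert_outer.
Proof.
move=> F; rewrite /hilbert_outer image_bigcup.
exact: outer_measure_sigma_subadditive.
Qed.

HB.instance Definition _ := isOuterMeasure.Build R hilbert_pointed hilbert_outer
  hilbert_outer0 hilbert_outer_ge0 le_hilbert_outer
  hilbert_outer_sigma_subadditive.

Definition hilbert_outer_measure :
  {outer_measure set hilbert_pointed -> \bar R} := hilbert_outer.

(* Since the outer measure comes from a sigma-finite Borel measure, its
   Caratheodory sigma-algebra is the completion of the Borel sets of H, i.e.
   the sigma-algebra of Lebesgue measurable sets. *)
Definition lebesgueType : Type := caratheodory_type hilbert_outer_measure.
HB.instance Definition _ := Measurable.on lebesgueType.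

Definition hilbert_lebesgue : {measure set lebesgueType -> \bar R} :=
  hilbert_outer_measure : set (caratheodory_type hilbert_outer_measure) -> \bar R.

End HilbertLebesgue.

(* Main.v *)
Require Import Defs.
From HB Require Import structures.
From mathcomp Require Import all_boot all_order all_algebra.
From mathcomp Require Import all_classical all_reals all_analysis.
From mathcomp Require Import measurable_realfun.
From mathcomp Require Import ess_sup_inf lra ring.
Import Order.TTheory GRing.Theory Num.Theory.
Import numFieldNormedType.Exports.

(* With t_j = 1/p_j and g_j = f_j^(p_j), the inequality reads
     int prod_j g_j(l_j y)^(t_j) dy <= C prod_j (int g_j)^(t_j),
   in coordinates where the l_j are matrices.

   Necessity: test it on indicators of boxes, of size r in the directions of
   V (resp. l_j V) and of bounded size in complementary directions. Volumes
   grow like r^(dim V) and r^(sum_j t_j dim(l_j V)); let r tend to infinity.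
   For V = H the powers r -> 0 are allowed too and give the equality.

   Sufficiency: induction on dim H. If some proper nonzero W is critical
   (equality holds for W), integrate along W first, then along a complement:
   both steps are instances of the inequality in smaller dimension, for the
   restrictions l_j : W -> l_j W and the quotients H/W -> H_j/l_j W. Otherwise
   pick two indices i, k with t_i, t_k > 0 and move (t_i, t_k) along the line
   that preserves the scaling equality, in both directions, until an exponent
   vanishes or a critical subspace appears. Both end points are settled by
   induction, and Hoelder's inequality interpolates between them. With only
   one positive exponent left, l_j is an isomorphism and t_j = 1.

   Every function is taken with values in [0, +oo], with 0 * +oo = 0, so the
   inequality can be applied to partial integrals without finiteness checks. *)

Set Implicit Arguments.
Unset Strict Implicit.
Unset Printing Implicit Defensive.

Local Open Scope classical_set_scope.
Local Open Scope ring_scope.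
Local Open Scope ereal_scope.

(** * Powers and finite products in the extended reals *)

Section ExtendedReals.
Context {R : realType}.
Implicit Types (x y : \bar R) (r s : R).

(** Nonnegative exponents discharge the side condition of [poweRD]. At [x = 0] both sides vanish
    once [r] is positive, and for [r = 0] the first factor is 1. *)
Lemma poweRD_ge0 x r s : (0 <= r)%R -> (0 <= s)%R ->
  x `^ (r + s) = x `^ r * x `^ s.
Proof.
move=> r0 s0; have [->|x0] := eqVneq x 0; last first.
  by apply: poweRD; apply: nneg_neq0_poweRD_def.
have [->|rn] := eqVneq r 0%R; first by rewrite add0r poweRe0 mul1e.
rewrite [0 `^ r]poweR0r// mul0e poweR0r// gt_eqF// ltr_wpDr// lt0r.
by rewrite rn r0.
Qed.

Lemma le_poweR r x y : (0 <= r)%R -> 0 <= x -> x <= y -> x `^ r <= y `^ r.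
Proof.
move=> r0 x0 xy; apply: (gt0_ler_poweR r0) => //; rewrite in_itv/= leey andbT//.
exact: le_trans xy.
Qed.

Lemma lee_prod (I : Type) (l : seq I) (P : pred I) (F G : I -> \bar R) :
  (forall i, P i -> 0 <= F i <= G i) ->
  \prod_(i <- l | P i) F i <= \prod_(i <- l | P i) G i.
Proof.
move=> FG.
suff : 0 <= \prod_(i <- l | P i) F i <= \prod_(i <- l | P i) G i by case/andP.
apply: (big_ind2 (fun x y => 0 <= x <= y)) => //.
  by rewrite lexx lee01.
move=> x1 x2 y1 y2 /andP[x0 x12] /andP[y0 y12].
by rewrite mule_ge0//= lee_pmul.
Qed.

Lemma prode_ge0 (I : Type) (l : seq I) (P : pred I) (F : I -> \bar R) :
  (forall i, P i -> 0 <= F i) -> 0 <= \prod_(i <- l | P i) F i.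
Proof. by move=> F0; apply: (big_ind (fun x => 0 <= x)) => // *; exact: mule_ge0. Qed.

Lemma poweR_prod (I : Type) (l : seq I) (P : pred I) (F : I -> \bar R) r :
  (forall i, 0 <= F i) ->
  (\prod_(i <- l | P i) F i) `^ r = \prod_(i <- l | P i) (F i `^ r).
Proof.
move=> F0; elim: l => [|i l IH]; first by rewrite !big_nil poweR1r.
by rewrite !big_cons; case: ifP => // _; rewrite poweRM ?IH// prode_ge0.
Qed.

Lemma prode_EFin (I : Type) (l : seq I) (P : pred I) (F : I -> R) :
  \prod_(i <- l | P i) (F i)%:E = (\prod_(i <- l | P i) F i)%R%:E.
Proof. by elim/big_rec2 : _ => // i y x _ ->. Qed.

(** Young's inequality for the conjugate exponents [(1 - s)^-1] and [s^-1]. *)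
Lemma powR_amgm (a b s : R) : (0 <= a)%R -> (0 <= b)%R -> (0 < s < 1)%R ->
  (a `^ (1 - s) * b `^ s <= (1 - s) * a + s * b)%R.
Proof.
move=> a0 b0 /andP[s0 s1]; have s10 : (0 < 1 - s)%R by rewrite subr_gt0.
have := @conjugate_powR R (a `^ (1 - s))%R (b `^ s)%R (1 - s)^-1%R s^-1%R
  (powR_ge0 _ _) (powR_ge0 _ _).
rewrite !invrK !invr_gt0 => /(_ s10 s0).
rewrite subrK -!powRrM !mulfV ?gt_eqF// !powRr1// => /(_ erefl).
by rewrite (mulrC a) (mulrC b).
Qed.

End ExtendedReals.

(** * Monotonicity of the integral and Hoelder's inequality *)

Section Integrals.
Context d (T : measurableType d) (R : realType).
Variable mu : {measure set T -> \bar R}.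

(** The integral of a nonnegative function is a supremum over the simple functions below it, hence
    monotone for arbitrary integrands. It serves for products of [f j (l j y)], whose measurability
    is never established. *)
Lemma ge0_le_integral_nomeas (f g : T -> \bar R) :
  (forall x, 0 <= f x) -> (forall x, f x <= g x) ->
  \int[mu]_x f x <= \int[mu]_x g x.
Proof.
move=> f0 fg; have g0 x : 0 <= g x by exact: le_trans (fg x).
rewrite !ge0_integralTE//; apply: le_ereal_sup => _ [h hf <-].
by exists h => // x; exact: le_trans (fg x).
Qed.

(** Divide [f] and [g] by their integrals and integrate the weighted arithmetic-geometric mean
    inequality pointwise. Zero and infinite integrals are treated first. *)
Lemma hoelder_interpolation (f g : T -> \bar R) (s : R) :
  measurable_fun setT f -> measurable_fun setT g ->
  (forall x, 0 <= f x) -> (forall x, 0 <= g x) -> (0 < s < 1)%R ->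
  \int[mu]_x (f x `^ (1 - s) * g x `^ s) <=
  (\int[mu]_x f x) `^ (1 - s) * (\int[mu]_x g x) `^ s.
Proof.
move=> mf mg f0 g0 s01; have /andP[s0 s1] := s01.
have s10 : (0 < 1 - s)%R by rewrite subr_gt0.
have mp : measurable_fun setT (fun x => f x `^ (1 - s) * g x `^ s).
  by apply: emeasurable_funM; apply: measurableT_comp (measurable_poweR _) _.
(* A factor of zero integral vanishes almost everywhere, and the product vanishes with it. *)
have null (h : T -> \bar R) : measurable_fun setT h -> (forall x, 0 <= h x) ->
    \int[mu]_x h x = 0 -> (forall x, h x = 0 -> f x `^ (1 - s) * g x `^ s = 0) ->
    \int[mu]_x (f x `^ (1 - s) * g x `^ s) = 0.
  move=> mh h0 ih hz.
  have : \int[mu]_x `|h x| = 0.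
    by rewrite -[RHS]ih; apply: eq_integral => x _; rewrite gee0_abs.
  move/(ae_eq_integral_abs mu measurableT mh) => h_ae.
  rewrite (@ge0_ae_eq_integral _ _ _ mu setT _ (cst 0))//.
  - by rewrite integral0.
  - by move=> x _; rewrite mule_ge0// poweR_ge0.
  - by apply: filterS h_ae => x /= /(_ I) /hz.
have [a0|a0] := eqVneq (\int[mu]_x f x) 0.
  rewrite (null f)//; first by rewrite mule_ge0// poweR_ge0.
  by move=> x ->; rewrite poweR0r ?mul0e// gt_eqF.
have [b0|b0] := eqVneq (\int[mu]_x g x) 0.
  rewrite (null g)//; first by rewrite mule_ge0// poweR_ge0.
  by move=> x ->; rewrite [0 `^ _]poweR0r ?mule0// gt_eqF.
have ap : 0 < \int[mu]_x f x by rewrite lt0e a0 integral_ge0.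
have bp : 0 < \int[mu]_x g x by rewrite lt0e b0 integral_ge0.
have [->|ay] := eqVneq (\int[mu]_x f x) +oo.
  by rewrite poweRyr ?gt_eqF// gt0_mulye ?leey// poweR_gt0.
have [->|byy] := eqVneq (\int[mu]_x g x) +oo.
  by rewrite poweRyr ?gt_eqF// gt0_muley ?leey// poweR_gt0.
move: ap bp ay byy.
move ia : (\int[mu]_x f x) => a'; move ib : (\int[mu]_x g x) => b'.
case: a' ia => // a ia; case: b' ib => // b ib.
rewrite !lte_fin => ap bp _ _.
(* [c] is the right-hand side. The weights [u] and [v] make [u * f + v * g] equal to [c] times the
   arithmetic mean of [f / a] and [g / b], so that its integral is exactly [c]. *)
pose c := (a `^ (1 - s) * b `^ s)%R.
have cp : (0 < c)%R by rewrite mulr_gt0// powR_gt0.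
pose u := (c * ((1 - s) / a))%R; pose v := (c * (s / b))%R.
have up : (0 < u)%R by apply: mulr_gt0 => //; exact: divr_gt0.
have vp : (0 < v)%R by apply: mulr_gt0 => //; exact: divr_gt0.
apply: (@le_trans _ _ (\int[mu]_x (u%:E * f x + v%:E * g x))).
  apply: ge0_le_integral => //.
  - by move=> x _; rewrite mule_ge0// poweR_ge0.
  - by apply: emeasurable_funD; apply: measurable_funeM.
  move=> x _; have := f0 x; have := g0 x.
  case: (f x) => [p| |]//; last first.
    move=> g0x _; rewrite gt0_muley ?lte_fin// addye ?leey//.
    by rewrite gt_eqF// (lt_le_trans (ltNyr 0%R))// mule_ge0// lee_fin ltW.
  case: (g x) => [q| |]//; last first.
    by move=> _ _; rewrite gt0_muley ?lte_fin// addey ?leey.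
  rewrite !lee_fin => q0 p0.
  have -> : (p `^ (1 - s) * q `^ s =
      c * ((p / a) `^ (1 - s) * (q / b) `^ s))%R.
    rewrite /c mulrACA -!powRM ?divr_ge0 ?(ltW ap) ?(ltW bp)//.
    by rewrite (mulrC a) (mulrC b) !divfK ?gt_eqF.
  have pa0 : (0 <= p / a)%R by rewrite divr_ge0// ltW.
  have qb0 : (0 <= q / b)%R by rewrite divr_ge0// ltW.
  apply: (@le_trans _ _ (c * ((1 - s) * (p / a) + s * (q / b)))%R).
    by rewrite ler_pM2l// powR_amgm.
  by rewrite /u /v mulrDr -!mulrA (mulrC p) (mulrC q).
rewrite ge0_integralD//; last 4 first.
- by move=> x _; rewrite mule_ge0// lee_fin ltW.
- exact: measurable_funeM.
- by move=> x _; rewrite mule_ge0// lee_fin ltW.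
- exact: measurable_funeM.
rewrite !ge0_integralZl//; try by rewrite lee_fin ltW.
rewrite ia ib -!EFinM -EFinD lee_fin /u /v -!mulrA !mulVf ?gt_eqF// !mulr1.
by rewrite -!mulrDr subrK mulr1.
Qed.

End Integrals.

(** * Lebesgue integration on row vectors *)

Section RowVectors.
Context {R : realType}.
Local Notation RB := (measurableTypeR R).

Definition row_of n (x : n.-tuple RB) : 'rV[R]_n := \row_i tnth x i.

Definition tuple_of_row n (v : 'rV[R]_n) : n.-tuple RB := [tuple v ord0 i | i < n].

Lemma tuple_of_rowK n : cancel (@tuple_of_row n) (@row_of n).
Proof. by move=> v; apply/rowP => i; rewrite mxE tnth_mktuple. Qed.

Lemma row_ofK n : cancel (@row_of n) (@tuple_of_row n).
Proof. by move=> x; apply: eq_from_tnth => i; rewrite tnth_mktuple mxE. Qed.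

(* ['rV[R]_n] has no measurable structure in the library; Borel measurability is
   read through tuples, on which [tuple_lebesgue] is defined. *)
Definition measurable_row n (F : 'rV[R]_n -> \bar R) :=
  measurable_fun setT (fun x : n.-tuple RB => F (row_of x)).

Definition measurable_to_row d (T : measurableType d) n (phi : T -> 'rV[R]_n) :=
  forall i, measurable_fun setT (fun t => phi t ord0 i : RB).

Section to_row.
Context d (T : measurableType d).

Lemma measurable_row_comp n (F : 'rV[R]_n -> \bar R) (phi : T -> 'rV[R]_n) :
  measurable_row F -> measurable_to_row phi ->
  measurable_fun setT (fun t => F (phi t)).
Proof.
move=> mF mphi.
rewrite (_ : (fun _ => _) = (fun x => F (row_of x)) \o
    (fun t => tuple_of_row (phi t))); last first.
  by apply/funext => t /=; rewrite tuple_of_rowK.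
apply: measurableT_comp => //; apply/measurable_fun_tnthP => i.
rewrite (_ : _ \o _ = fun t => phi t ord0 i)//.
by apply/funext => t /=; rewrite tnth_mktuple.
Qed.

Lemma measurable_to_row_cst n (a : 'rV[R]_n) :
  measurable_to_row (fun _ : T => a).
Proof. by move=> i; exact: measurable_cst. Qed.

Lemma measurable_to_rowD n (f g : T -> 'rV[R]_n) : measurable_to_row f ->
  measurable_to_row g -> measurable_to_row (fun t => (f t + g t)%R).
Proof.
move=> mf mg i; under eq_fun do rewrite mxE.
exact: (measurable_funD (mf i) (mg i)).
Qed.

Lemma measurable_to_rowM n p (f : T -> 'rV[R]_n) (M : 'M[R]_(n, p)) :
  measurable_to_row f -> measurable_to_row (fun t => (f t *m M)%R).
Proof.
move=> mf i; under eq_fun do rewrite mxE.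
by apply: measurable_sum => j; exact: measurable_funM (mf j) (measurable_cst _).
Qed.

Lemma measurable_to_row_mx n p (f : T -> 'rV[R]_n) (g : T -> 'rV[R]_p) :
  measurable_to_row f -> measurable_to_row g ->
  measurable_to_row (fun t => row_mx (f t) (g t)).
Proof.
move=> mf mg i; under eq_fun do rewrite mxE.
by case: (fintype.split i).
Qed.

Lemma measurable_to_row_scalar (f : T -> RB) : measurable_fun setT f ->
  measurable_to_row (fun t => (f t)%:M : 'rV[R]_1).
Proof. by move=> mf i; rewrite (ord1 i); under eq_fun do rewrite mxE/=. Qed.

End to_row.

Lemma measurable_row_of n : measurable_to_row (@row_of n).
Proof. by move=> i; under eq_fun do rewrite mxE; exact: measurable_tnth. Qed.

Lemma measurable_to_row_comp d d' (T : measurableType d) (T' : measurableType d')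
    n (f : T -> 'rV[R]_n) (g : T' -> T) :
  measurable_to_row f -> measurable_fun setT g -> measurable_to_row (f \o g).
Proof. by move=> mf mg i; exact: measurableT_comp (mf i) mg. Qed.

Lemma measurable_row_of_fst d (T : measurableType d) n :
  measurable_to_row (fun z : n.-tuple RB * T => row_of z.1).
Proof. exact: measurable_to_row_comp (@measurable_row_of n) measurable_fst. Qed.

Lemma measurable_row_of_snd d (T : measurableType d) n :
  measurable_to_row (fun z : T * n.-tuple RB => row_of z.2).
Proof. exact: measurable_to_row_comp (@measurable_row_of n) measurable_snd. Qed.

Lemma measurable_row_affine n p (F : 'rV[R]_p -> \bar R) (M : 'M[R]_(n, p)) a :
  measurable_row F -> measurable_row (fun v => F (v *m M + a)%R).
Proof.
move=> mF; apply: (measurable_row_comp (phi := fun x => row_of x *m M + a)%R).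
  exact: mF.
apply: measurable_to_rowD.
  apply: measurable_to_rowM; exact: measurable_row_of.
exact: measurable_to_row_cst.
Qed.

Lemma measurable_row_mulmx n p (F : 'rV[R]_p -> \bar R) (M : 'M[R]_(n, p)) :
  measurable_row F -> measurable_row (fun v => F (v *m M)).
Proof.
move=> mF; apply: (measurable_row_comp (phi := fun x => row_of x *m M)) => //.
by apply: measurable_to_rowM; exact: measurable_row_of.
Qed.

Lemma measurable_rowD n (F : 'rV[R]_n -> \bar R) a :
  measurable_row F -> measurable_row (fun v => F (v + a)%R).
Proof.
move=> mF; apply: (measurable_row_comp (phi := fun x => row_of x + a)%R) => //.
apply: measurable_to_rowD.
  exact: measurable_row_of.
exact: measurable_to_row_cst.
Qed.

Definition lint n (F : 'rV[R]_n -> \bar R) : \bar R :=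
  \int[tuple_lebesgue n]_x F (row_of x).

Lemma lint_ge0 n (F : 'rV[R]_n -> \bar R) : (forall v, 0 <= F v) -> 0 <= lint F.
Proof. by move=> F0; exact: integral_ge0. Qed.

Lemma eq_lint n (F G : 'rV[R]_n -> \bar R) : F =1 G -> lint F = lint G.
Proof. by move=> FG; apply: eq_integral => x _; exact: FG. Qed.

Lemma le_lint n (F G : 'rV[R]_n -> \bar R) :
  (forall v, 0 <= F v) -> (forall v, F v <= G v) -> lint F <= lint G.
Proof. by move=> F0 FG; exact: ge0_le_integral_nomeas. Qed.

Lemma lintZl n (F : 'rV[R]_n -> \bar R) k : measurable_row F ->
  (forall v, 0 <= F v) -> 0 <= k -> lint (fun v => k * F v) = k * lint F.
Proof. by move=> mF F0 k0; rewrite /lint ge0_integralZl. Qed.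

Lemma lintZr n (F : 'rV[R]_n -> \bar R) k : measurable_row F ->
  (forall v, 0 <= F v) -> 0 <= k -> lint (fun v => F v * k) = lint F * k.
Proof.
by move=> mF F0 k0; under eq_lint do rewrite muleC; rewrite lintZl// muleC.
Qed.

Lemma lint0 (F : 'rV[R]_0 -> \bar R) : lint F = F 0%R.
Proof.
rewrite /lint /tuple_lebesgue.
rewrite (_ : (fun _ => _) = cst (F 0%R)); last first.
  by apply/funext => x; rewrite /=; congr F; by apply/rowP => -[].
rewrite integral_dirac; [|exact: measurableT|by []].
by rewrite diracT mul1e.
Qed.

(** Tonelli's theorem for the product whose pushforward along [tuple_cons] defines the measure in
    dimension [n.+1]. *)
Lemma lintS n (F : 'rV[R]_n.+1 -> \bar R) : measurable_row F ->
  (forall v, 0 <= F v) ->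
  lint F = \int[lebesgue_measure]_x
    lint (fun v : 'rV[R]_n => F (row_mx (x%:M : 'rV_1) v)).
Proof.
move=> mF F0; rewrite /lint /=.
pose G (z : RB * n.-tuple RB) := F (row_mx (z.1%:M : 'rV_1) (row_of z.2)).
have GE z : F (row_of (tuple_cons z)) = G z.
  congr F; apply/rowP => i; rewrite !mxE; case: fintype.splitP => j /= ij.
    by rewrite mxE (tnth_nth 0%R) ij !ord1 /= mulr1n.
  by rewrite mxE !(tnth_nth 0%R) ij.
have mG : measurable_fun setT G.
  rewrite (_ : G = (fun x => F (row_of x)) \o @tuple_cons R n); last first.
    by apply/funext => z; rewrite /= GE.
  by apply: measurableT_comp => //; exact: measurable_tuple_cons.
transitivity (\int[pushforward (lebesgue_measure \x tuple_lebesgue n)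
   (@tuple_cons R n)]_x F (row_of x)); first by [].
rewrite ge0_integral_pushforward//; last exact: measurable_tuple_cons.
rewrite preimage_setT -(fubini_tonelli1 G mG (fun=> F0 _)).
by apply: eq_integral => z _; rewrite /= GE.
Qed.

Lemma measurable_lint d (T : measurableType d) n (G : T -> 'rV[R]_n -> \bar R) :
  measurable_fun setT (fun z : T * n.-tuple RB => G z.1 (row_of z.2)) ->
  (forall t v, 0 <= G t v) ->
  measurable_fun setT (fun t => lint (G t)).
Proof.
move=> mG G0.
exact: (@measurable_fun_fubini_tonelli_F _ _ _ _ _ (tuple_lebesgue n)
  (fun z : T * n.-tuple RB => G z.1 (row_of z.2))).
Qed.

(** The image of Lebesgue measure under a translation has the right values on half-open intervals,
    so uniqueness identifies the two measures. *)
Lemma lebesgue_integral_shift (f : RB -> \bar R) (a : R) :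
  measurable_fun setT f -> (forall x, 0 <= f x) ->
  \int[lebesgue_measure]_x f (x + a)%R = \int[lebesgue_measure]_x f x.
Proof.
move=> mf f0; pose phi (x : RB) : RB := (x + a)%R.
have mphi : measurable_fun setT phi.
  by apply: measurable_funD => //; exact: measurable_cst.
transitivity (\int[pushforward lebesgue_measure phi]_x f x).
  by rewrite ge0_integral_pushforward// preimage_setT.
apply: eq_measure_integral => /= A mA _.
apply/esym/lebesgue_measure_unique => //= _ [[b c]] _ <-.
rewrite /pushforward (_ : phi @^-1` _ = [set` `](b - a)%R, (c - a)%R]]).
  rewrite !lebesgue_measure_itv/= !lte_fin ltrD2r.
  by case: ifPn => // _; rewrite -!EFinD opprB addrA subrK.
by apply/seteqP; split => x /=; rewrite !in_itv/= ltrBlDr lerBrDr.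
Qed.

Lemma lint_shift n (F : 'rV[R]_n -> \bar R) a : measurable_row F ->
  (forall v, 0 <= F v) -> lint (fun v => F (v + a)%R) = lint F.
Proof.
elim: n => [|n IH] in F a *.
  by move=> _ _; rewrite !lint0; congr F; apply/rowP => -[].
move=> mF F0.
have mFr : measurable_fun setT (fun z : RB * n.-tuple RB =>
    F (row_mx (z.1%:M : 'rV_1) (row_of z.2))).
  apply: (measurable_row_comp (phi := fun z : RB * n.-tuple RB =>
    row_mx (z.1%:M : 'rV_1) (row_of z.2))) => //.
  apply: measurable_to_row_mx; last exact: measurable_row_of_snd.
  exact: measurable_to_row_scalar.
rewrite (lintS mF F0) (lintS (measurable_rowD a mF) (fun=> F0 _)).
pose h x := lint (fun v : 'rV[R]_n => F (row_mx (x%:M : 'rV_1) v)).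
transitivity (\int[lebesgue_measure]_x h (x + a ord0 ord0)%R).
  apply: eq_integral => x _.
  rewrite /h -[RHS](IH _ (rsubmx (a : 'rV_(1 + n)))) //.
    apply: eq_lint => v; congr F.
    transitivity (row_mx (x%:M : 'rV_1) v +
        row_mx (lsubmx (a : 'rV_(1 + n))) (rsubmx (a : 'rV_(1 + n))))%R.
      by rewrite hsubmxK.
    rewrite add_row_mx.
    suff -> : (x%:M + lsubmx (a : 'rV_(1 + n)) = (x + a ord0 ord0)%:M :> 'rV_1)%R.
      by [].
    apply/rowP => i; rewrite (ord1 i) !mxE/= !mulr1n; congr (_ + a _ _)%R.
    exact/val_inj.
  apply: (measurable_row_comp (phi := fun t => row_mx _ (row_of t))) => //.
  apply: measurable_to_row_mx; last exact: measurable_row_of.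
  exact: measurable_to_row_cst.
rewrite lebesgue_integral_shift//; last by move=> x; exact: lint_ge0.
exact: (measurable_lint mFr).
Qed.

Lemma lint_swap n p (G : 'rV[R]_n -> 'rV[R]_p -> \bar R) :
  measurable_fun setT (fun z : n.-tuple RB * p.-tuple RB =>
    G (row_of z.1) (row_of z.2)) ->
  (forall v w, 0 <= G v w) ->
  lint (fun v => lint (G v)) = lint (fun w => lint (G^~ w)).
Proof.
move=> mG G0.
exact: (fubini_tonelli (m1 := tuple_lebesgue n) (m2 := tuple_lebesgue p)
  (fun z => G (row_of z.1) (row_of z.2))).
Qed.

Lemma lint_row_mx n p (F : 'rV[R]_(n + p) -> \bar R) : measurable_row F ->
  (forall v, 0 <= F v) ->
  lint F = lint (fun v => lint (fun w => F (row_mx v w))).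
Proof.
elim: n => [|n IH] in F *.
  move=> _ _; rewrite lint0; apply: eq_lint => v; congr F.
  apply/rowP => i; rewrite -(row_mxEr (0 : 'rV_0) v).
  by congr (row_mx _ _ _ _); exact/val_inj.
move=> mF F0.
have mFr : measurable_fun setT (fun z : n.+1.-tuple RB * p.-tuple RB =>
    F (row_mx (row_of z.1) (row_of z.2))).
  apply: (measurable_row_comp (phi := fun z : n.+1.-tuple RB * p.-tuple RB =>
    row_mx (row_of z.1) (row_of z.2))) => //.
  apply: measurable_to_row_mx; last exact: measurable_row_of_snd.
  exact: measurable_row_of_fst.
rewrite (lintS (F := fun v => lint (fun w => F (row_mx v w)))); last 2 first.
- exact: (measurable_lint mFr).
- by move=> v; exact: lint_ge0.
rewrite (lintS (n := n + p) mF F0); apply: eq_integral => x _.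
have mFx : measurable_row (fun u : 'rV[R]_(n + p) => F (row_mx (x%:M : 'rV_1) u)).
  apply: (measurable_row_comp (phi := fun t => row_mx _ (row_of t))) => //.
  apply: measurable_to_row_mx; last exact: measurable_row_of.
  exact: measurable_to_row_cst.
rewrite (IH _ mFx (fun=> F0 _)).
(* The lengths [1 + (n + p)] and [(1 + n) + p] are convertible, so the cast introduced by
   associativity is the identity. *)
apply: eq_lint => v; apply: eq_lint => w; congr F; rewrite row_mxA.
by rewrite (eq_irrelevance (esym _) erefl) castmx_id.
Qed.

End RowVectors.

(** * Cubes and linear changes of variables *)

Section LinearChangeOfVariables.
Context {R : realType}.
Local Notation RB := (measurableTypeR R).

(** The product form gives measurability and the volume coordinate by coordinate; [cubeE] gives the
    Boolean form used for inclusions. *)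
Definition cube n (r : R) (v : 'rV[R]_n) : \bar R :=
  (\prod_(i < n) \1_(`[- r, r]%classic : set R) (v ord0 i))%R%:E.

Lemma cubeE n (r : R) (v : 'rV[R]_n) :
  cube r v = ([forall i, (`|v ord0 i| <= r)%R]%:R)%:E.
Proof.
congr EFin; case: (boolP [forall _, _]) => [/forallP h|].
  rewrite big1// => i _; rewrite indicE mem_set//= in_itv/=.
  by rewrite -ler_norml h.
rewrite negb_forall => /existsP[i hi]; rewrite (bigD1 i)//= indicE memNset ?mul0r//.
by move=> /=; rewrite in_itv/= -ler_norml; exact/negP.
Qed.

Lemma cube_ge0 n r (v : 'rV[R]_n) : 0 <= cube r v.
Proof. by rewrite cubeE lee_fin. Qed.

Lemma cube_opp n r (v : 'rV[R]_n) : cube r (- v)%R = cube r v.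
Proof.
rewrite !cubeE; congr (_%:R%:E); congr nat_of_bool.
by apply: eq_forallb => i; rewrite mxE normrN.
Qed.

Lemma measurable_cube n r : measurable_row (@cube n r).
Proof.
apply/measurable_EFinP; apply: measurable_prod => i _.
apply: measurableT_comp; first exact: measurable_indic.
exact: measurable_row_of.
Qed.

Lemma lint_cube n (r : R) : (0 <= r)%R -> lint (@cube n r) = ((2 * r) ^+ n)%:E.
Proof.
move=> r0; elim: n => [|n IH]; first by rewrite lint0 /cube big_ord0.
rewrite lintS//; [|exact: measurable_cube|exact: cube_ge0].
transitivity (\int[lebesgue_measure]_x
    ((\1_(`[- r, r]%classic : set R) x)%:E * lint (@cube n r))).
  apply: eq_integral => x _; rewrite -lintZl//.
  - apply: eq_lint => v; rewrite /cube big_ord_recl EFinM; congr (_ * _).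
      congr (\1__ _)%:E.
      rewrite -[RHS](_ : (row_mx (x%:M : 'rV_1) v) ord0 (lshift n ord0) = x).
        by congr (row_mx _ _ _ _); exact/val_inj.
      by rewrite row_mxEl mxE eqxx mulr1n.
    congr EFin; apply: eq_bigr => i _.
    congr (\1__ _); rewrite -(row_mxEr (x%:M : 'rV_1) v).
    by congr (row_mx _ _ _ _); exact/val_inj.
  - exact: measurable_cube.
  - exact: cube_ge0.
rewrite ge0_integralZr//; last 2 first.
- by apply/measurable_EFinP; exact: measurable_indic.
- by apply: lint_ge0 => v; exact: cube_ge0.
rewrite integral_indic//= setIT IH lebesgue_measure_itv/= lte_fin.
case: ltP => [_|rr].
  by rewrite opprK -EFinD -EFinM exprS mulr_natl mulr2n.
rewrite mul0e (_ : r = 0)%R ?mulr0 ?expr0n//.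
by apply/eqP; rewrite eq_le r0 andbT -(oppr_ge0); lra.
Qed.

(** A crude bound for the operator norm of [v *m M] with respect to sup norms. *)
Definition mx_l1 n p (M : 'M[R]_(n, p)) : R := (\sum_i \sum_j `|M i j|)%R.

Lemma mx_l1_ge0 n p (M : 'M[R]_(n, p)) : (0 <= mx_l1 M)%R.
Proof. by apply: sumr_ge0 => i _; exact: sumr_ge0. Qed.

Lemma coord_mulmx_le n p (M : 'M[R]_(n, p)) r (v : 'rV[R]_n) i :
  (forall k, `|v ord0 k| <= r)%R -> (`|(v *m M) ord0 i| <= r * mx_l1 M)%R.
Proof.
move=> vr; rewrite mxE (le_trans (ler_norm_sum _ _ _))// mulr_sumr.
apply: ler_sum => k _; rewrite normrM ler_pM// (bigD1 i)//= lerDl.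
exact: sumr_ge0.
Qed.

Lemma cube_mulmx_le n p (M : 'M[R]_(n, p)) r (v : 'rV[R]_n) :
  cube r v <= cube (r * mx_l1 M) (v *m M).
Proof.
rewrite !cubeE lee_fin; case: (boolP [forall _, _]) => // /forallP vr.
suff -> : [forall i, (`|(v *m M) ord0 i| <= r * mx_l1 M)%R] by [].
by apply/forallP => i; exact: coord_mulmx_le.
Qed.

Lemma measurable_row_prod_shift n p q (f : 'rV[R]_q -> \bar R)
    (M : 'M[R]_(n, q)) (N : 'M[R]_(p, q)) :
  measurable_row f ->
  measurable_fun setT (fun z : n.-tuple RB * p.-tuple RB =>
    f (row_of z.1 *m M + row_of z.2 *m N)%R).
Proof.
move=> mf; apply: (measurable_row_comp (phi := fun z : n.-tuple RB * p.-tuple RB =>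
    (row_of z.1 *m M + row_of z.2 *m N)%R)) => //.
apply: measurable_to_rowD; apply: measurable_to_rowM.
  exact: measurable_row_of_fst.
exact: measurable_row_of_snd.
Qed.

(* The classical proof that Haar measure is unique up to a factor: both sides
   are the integral of [f (x *m M) * h (y - x *m M)] in x and y. *)
Lemma lint_mulmx_haar n p (M : 'M[R]_(p, n)) (N : 'M[R]_(n, p))
    (f h : 'rV[R]_n -> \bar R) : N *m M = 1%:M ->
  measurable_row f -> measurable_row h ->
  (forall v, 0 <= f v) -> (forall v, 0 <= h v) ->
  lint (fun x => f (x *m M)) * lint h =
  lint (fun x => h (- (x *m M))%R) * lint f.
Proof.
move=> NM mf mh f0 h0.
pose G (x : 'rV[R]_p) (y : 'rV[R]_n) := f (x *m M) * h (y - x *m M)%R.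
pose K (x : 'rV[R]_p) (y : 'rV[R]_n) := h (- (x *m M))%R * f (y + x *m M)%R.
have mfst (g : 'rV[R]_n -> \bar R) (L : 'M[R]_(p, n)) : measurable_row g ->
    measurable_fun setT (fun z : p.-tuple RB * n.-tuple RB => g (row_of z.1 *m L)).
  move=> mg.
  apply: (measurable_row_comp (phi := fun z : p.-tuple RB * n.-tuple RB =>
    row_of z.1 *m L)) => //.
  by apply: measurable_to_rowM; exact: measurable_row_of_fst.
have mG : measurable_fun setT (fun z : p.-tuple RB * n.-tuple RB =>
    G (row_of z.1) (row_of z.2)).
  apply: emeasurable_funM; first exact: mfst.
  have := @measurable_row_prod_shift p n n h (- M)%R 1%:M mh.
  by under eq_fun do rewrite mulmx1 mulmxN addrC.
have mK : measurable_fun setT (fun z : p.-tuple RB * n.-tuple RB =>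
    K (row_of z.1) (row_of z.2)).
  apply: emeasurable_funM.
    by have := mfst h (- M)%R mh; under eq_fun do rewrite mulmxN.
  have := @measurable_row_prod_shift p n n f M 1%:M mf.
  by under eq_fun do rewrite mulmx1 addrC.
transitivity (lint (fun x => lint (G x))).
  rewrite -lintZr//; last 2 first.
  - exact: measurable_row_mulmx.
  - exact: lint_ge0.
  apply: eq_lint => x; rewrite -(lint_shift (- (x *m M))%R mh h0) -lintZl//.
  exact: measurable_rowD.
rewrite lint_swap//; last by move=> v w; rewrite mule_ge0.
transitivity (lint (fun y => lint (fun x => K x y))).
  apply: eq_lint => y.
  (* Since [N *m M] is the identity, shifting [x] by [y *m N] adds [y] to [x *m M], which turns [G]
     into [K]. *)
  rewrite -[LHS](lint_shift (y *m N)); last 2 first.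
  - apply: emeasurable_funM.
      exact: measurable_row_mulmx.
    have := @measurable_row_affine _ p n h (- M)%R y mh.
    by rewrite /measurable_row; under eq_fun do rewrite mulmxN addrC.
  - by move=> v; rewrite mule_ge0.
  apply: eq_lint => x; rewrite /G /K mulmxDl -mulmxA NM mulmx1 muleC opprD.
  by rewrite addrCA subrr addr0 (addrC y).
rewrite -lint_swap//; last by move=> v w; rewrite mule_ge0.
rewrite -lintZr//; last 2 first.
- have := @measurable_row_mulmx _ p n h (- M)%R mh.
  by rewrite /measurable_row; under eq_fun do rewrite mulmxN.
- exact: lint_ge0.
apply: eq_lint => x; rewrite -(lint_shift (x *m M) mf f0) -lintZl//.
exact: measurable_rowD.
Qed.

(** The identity [lint_mulmx_haar] is tested on the unit cube, whose volume is positive and finite.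
    Surjective maps thus pull null functions back to null functions, as the exceptional sets in
    [bl_hilbert] require. *)
Lemma lint_mulmx_null n p (M : 'M[R]_(p, n)) (N : 'M[R]_(n, p))
    (f : 'rV[R]_n -> \bar R) : N *m M = 1%:M ->
  measurable_row f -> (forall v, 0 <= f v) ->
  lint f = 0 -> lint (fun x => f (x *m M)) = 0.
Proof.
move=> NM mf f0 if0.
have := lint_mulmx_haar NM mf (@measurable_cube n 1) f0 (cube_ge0 _).
rewrite if0 mule0 lint_cube// => /eqP; rewrite mule_eq0 => /orP[/eqP//|].
by rewrite eqe mulr1 expf_eq0 pnatr_eq0/= andbF.
Qed.

(** Only the existence of a Jacobian matters, so no determinant is computed: the factor is read off
    from the cube of radius 1. *)
Lemma lint_mulmx n p (M : 'M[R]_(p, n)) (N : 'M[R]_(n, p)) :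
  N *m M = 1%:M -> M *m N = 1%:M ->
  exists2 c : R, (0 < c)%R & forall f : 'rV[R]_n -> \bar R,
    measurable_row f -> (forall v, 0 <= f v) ->
    lint (fun x => f (x *m M)) = c%:E * lint f.
Proof.
move=> NM MN; pose c := lint (fun x => @cube n 1 (x *m M)).
have haar (f : 'rV[R]_n -> \bar R) : measurable_row f -> (forall v, 0 <= f v) ->
    lint (fun x => f (x *m M)) * (2 ^+ n)%:E = c * lint f.
  move=> mf f0.
  have := lint_mulmx_haar NM mf (@measurable_cube n 1) f0 (cube_ge0 _).
  rewrite lint_cube ?ler01 ?mulr1 => [->|//]; congr (_ * _).
  by apply: eq_lint => x; rewrite cube_opp.
have c0 : 0 <= c by apply: lint_ge0 => v; exact: cube_ge0.
(* If [x *m M] lies in the unit cube, then [x = x *m M *m N] lies in the cube of radius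
   [mx_l1 N]. *)
have coo : c < +oo.
  apply: (@le_lt_trans _ _ (lint (@cube p (mx_l1 N)))).
    apply: le_lint => v; first exact: cube_ge0.
    have := cube_mulmx_le N 1 (v *m M).
    by rewrite mul1r -mulmxA MN mulmx1.
  by rewrite lint_cube ?ltry// mx_l1_ge0.
have m1 k : measurable_row (fun _ : 'rV[R]_k => 1 : \bar R).
  exact: measurable_cst.
(* If [c] were zero, the constant function 1 would have integral zero, although it dominates the
   unit cube. *)
have cp : 0 < c.
  rewrite lt0e c0 andbT; apply/eqP => c00.
  have /eqP := haar _ (m1 n) (fun=> lee01).
  rewrite c00 mul0e mule_eq0 eqe expf_eq0 pnatr_eq0 andbF orbF => /eqP.
  apply/eqP; rewrite gt_eqF// (@lt_le_trans _ _ (lint (@cube p 1)))//.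
    by rewrite lint_cube// lte_fin exprn_gt0// mulr1.
  apply: le_lint => v; first exact: cube_ge0.
  by rewrite cubeE lee_fin; case: [forall _, _].
exists (fine c / 2 ^+ n)%R.
  by rewrite divr_gt0 ?exprn_gt0// fine_gt0// cp.
move=> f mf f0; have := haar f mf f0.
have -> : c = (fine c)%:E by rewrite fineK// ge0_fin_numE.
move=> /(congr1 (fun z => z * ((2 ^+ n)^-1)%:E)).
rewrite -muleA -EFinM mulfV ?mule1; last by rewrite expf_neq0.
by move=> ->; rewrite muleAC -EFinM.
Qed.

End LinearChangeOfVariables.

(** * Sufficiency *)

Section BrascampLieb.
Context {R : realType}.
Local Notation RB := (measurableTypeR R).

(* [t j] stands for [1/p_j]. Since [x `^ 0 = 1] even for [x = 0] and [x = +oo],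
   an index with [t j = 0] plays no role. *)
Definition bl_bounded m n (nj : 'I_m -> nat) (A : forall j, 'M[R]_(n, nj j))
    (t : 'I_m -> R) :=
  exists2 C : R, (0 <= C)%R & forall g : forall j, 'rV[R]_(nj j) -> \bar R,
    (forall j, measurable_row (g j)) -> (forall j v, 0 <= g j v) ->
    lint (fun x => \prod_j (g j (x *m A j) `^ t j)) <=
    C%:E * \prod_j (lint (g j) `^ t j).

Definition bl_condition m n (nj : 'I_m -> nat) (A : forall j, 'M[R]_(n, nj j))
    (t : 'I_m -> R) :=
  (n%:R = \sum_j t j * (nj j)%:R)%R /\
  forall q (W : 'M[R]_(q, n)),
    ((\rank W)%:R <= \sum_j t j * (\rank (W *m A j))%:R)%R.

Lemma measurable_prod_poweR d (T : measurableType d) (I : Type) (r : seq I)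
    (h : I -> T -> \bar R) (t : I -> R) :
  (forall j, measurable_fun setT (h j)) ->
  measurable_fun setT (fun x => \prod_(j <- r) (h j x `^ t j)).
Proof.
move=> mh; elim: r => [|j r IH].
  by under eq_fun do rewrite big_nil; exact: measurable_cst.
under eq_fun do rewrite big_cons; apply: emeasurable_funM => //.
exact: measurableT_comp (measurable_poweR _) (mh j).
Qed.

Section data.
Variables (m n : nat) (nj : 'I_m -> nat) (A : forall j, 'M[R]_(n, nj j)).

Lemma measurable_row_bl (g : forall j, 'rV[R]_(nj j) -> \bar R) (t : 'I_m -> R) :
  (forall j, measurable_row (g j)) ->
  measurable_row (fun x => \prod_j (g j (x *m A j) `^ t j)).
Proof.
move=> mg; apply: measurable_prod_poweR => j.
exact: measurable_row_mulmx.
Qed.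

Lemma bl_ge0 (g : forall j, 'rV[R]_(nj j) -> \bar R) (t : 'I_m -> R) x :
  0 <= \prod_j (g j (x *m A j) `^ t j).
Proof. by apply: prode_ge0 => j _; exact: poweR_ge0. Qed.

(** A product with the intermediate exponents is a geometric mean of the products for [t0] and [t1].
    Hoelder's inequality bounds the left side, and the same splitting regroups the right side. *)
Lemma bl_interpolation (t0 t1 : 'I_m -> R) (s : R) :
  (forall j, 0 <= t0 j)%R -> (forall j, 0 <= t1 j)%R -> (0 < s < 1)%R ->
  bl_bounded A t0 -> bl_bounded A t1 ->
  bl_bounded A (fun j => (1 - s) * t0 j + s * t1 j)%R.
Proof.
move=> t00 t10 s01 [C0 C00 H0] [C1 C10 H1]; have /andP[s0 s1] := s01.
have s10 : (0 < 1 - s)%R by rewrite subr_gt0.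
exists (C0 `^ (1 - s) * C1 `^ s)%R; first by rewrite mulr_ge0 ?powR_ge0.
move=> g mg g0.
have powE (h : 'I_m -> \bar R) : (forall j, 0 <= h j) ->
    \prod_j (h j `^ ((1 - s) * t0 j + s * t1 j)) =
    (\prod_j (h j `^ t0 j)) `^ (1 - s) * (\prod_j (h j `^ t1 j)) `^ s.
  move=> h0; rewrite !poweR_prod; try by move=> j; exact: poweR_ge0.
  rewrite -big_split/=; apply: eq_bigr => j _; rewrite -!poweRrM.
  by rewrite -poweRD_ge0 ?mulr_ge0 ?(ltW s0) ?(ltW s10)// mulrC (mulrC s).
under eq_lint do rewrite powE//.
rewrite powE; last by move=> j; exact: lint_ge0.
apply: (le_trans (hoelder_interpolation _ (measurable_row_bl t0 mg)
  (measurable_row_bl t1 mg) (fun=> bl_ge0 _ _ _) (fun=> bl_ge0 _ _ _) s01)).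
rewrite EFinM -!poweR_EFin muleACA -!poweRM ?lee_fin//; last 2 first.
- by apply: prode_ge0 => j _; exact: poweR_ge0.
- by apply: prode_ge0 => j _; exact: poweR_ge0.
apply: lee_pmul; rewrite ?poweR_ge0//; apply: le_poweR; rewrite ?(ltW s0) ?(ltW s10)//.
- by apply: integral_ge0 => x _; exact: bl_ge0.
- exact: H0.
- by apply: integral_ge0 => x _; exact: bl_ge0.
- exact: H1.
Qed.

Lemma lint_dim0 k (F : 'rV[R]_k -> \bar R) v : k = 0%N -> lint F = F v.
Proof.
by move=> k0; move: F v; rewrite k0 => F v; rewrite lint0; congr F; apply/rowP => -[].
Qed.

(** All factors but the one of index [j0] are constant, being zeroth powers or functions on a point.
    What remains is a linear change of variables. *)
Lemma bl_invertible (t : 'I_m -> R) j0 (N : 'M[R]_(nj j0, n)) :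
  t j0 = 1%R -> (forall j, j != j0 -> t j = 0%R \/ nj j = 0%N) ->
  N *m A j0 = 1%:M -> A j0 *m N = 1%:M -> bl_bounded A t.
Proof.
move=> tj0 tj NA AN; have [c c0 cE] := lint_mulmx NA AN.
exists c; first exact: ltW.
move=> g mg g0; rewrite (bigD1 j0)//= tj0 poweRe1 ?lint_ge0// muleA -cE//.
rewrite -(lintZr (measurable_row_mulmx _ (mg j0)) (fun=> g0 _ _)); last first.
  by apply: prode_ge0 => j _; exact: poweR_ge0.
apply: le_lint => x; first exact: bl_ge0.
rewrite (bigD1 j0)//= tj0 poweRe1// (eq_bigr (fun j => lint (g j) `^ t j))//.
move=> j /tj[->|nj0]; first by rewrite !poweRe0.
by rewrite (lint_dim0 (g j) (x *m A j) nj0).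
Qed.

End data.

Section complement_basis.
Variables (q n : nat) (W : 'M[R]_(q, n)).

(** Square only up to the equation [rank_compl_add], which is why [pinvmx] plays the part of its
    inverse. *)
Definition compl_basis : 'M[R]_(\rank W + \rank (W^C)%MS, n) :=
  col_mx (row_base W) (row_base (W^C)%MS).

Lemma compl_basis_eq1 : (compl_basis :=: 1%:M)%MS.
Proof.
apply/eqmxP; rewrite submx1/= /compl_basis -addsmxE.
rewrite (adds_eqmx (eq_row_base _) (eq_row_base _)).
by rewrite sub1mx addsmx_compl_full.
Qed.

Lemma rank_compl_add : (\rank W + \rank (W^C)%MS = n)%N.
Proof. by rewrite mxrank_compl subnKC// rank_leq_col. Qed.

Lemma compl_basis_free : row_free compl_basis.
Proof. by rewrite /row_free compl_basis_eq1 mxrank1 rank_compl_add. Qed.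

Lemma compl_basisV : pinvmx compl_basis *m compl_basis = 1%:M.
Proof. by rewrite -[X in X *m _]mul1mx mulmxKpV// compl_basis_eq1. Qed.

Lemma compl_basisK : compl_basis *m pinvmx compl_basis = 1%:M.
Proof. exact: mulmxVp compl_basis_free. Qed.

End complement_basis.

(** Change of variables followed by Tonelli. The complement variable [z] is outermost, so the inner
    integral runs along translates of [W]. *)
Lemma lint_compl_basis q n (W : 'M[R]_(q, n)) :
  exists2 c : R, (0 < c)%R & forall f : 'rV[R]_n -> \bar R,
    measurable_row f -> (forall v, 0 <= f v) ->
    lint (fun z => lint (fun w => f (w *m row_base W + z *m row_base (W^C)%MS)%R))
    = c%:E * lint f.
Proof.
have [c c0 cE] := lint_mulmx (compl_basisV W) (compl_basisK W).
exists c => // f mf f0.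
rewrite -cE// (lint_row_mx (measurable_row_mulmx _ mf) (fun=> f0 _)).
transitivity (lint (fun w => lint (fun z =>
    f (w *m row_base W + z *m row_base (W^C)%MS)%R))); last first.
  by apply: eq_lint => w; apply: eq_lint => z; rewrite mul_row_col.
exact/esym/(lint_swap (measurable_row_prod_shift _ _ mf)).
Qed.

(** * The critical case: splitting along a subspace and its quotient *)

Section critical.
Variables (m n : nat) (nj : 'I_m -> nat) (A : forall j, 'M[R]_(n, nj j)).
Variables (t : 'I_m -> R) (q : nat) (W : 'M[R]_(q, n)).
Hypothesis t0 : forall j, (0 <= t j)%R.
Hypothesis condA : bl_condition A t.
Hypothesis Wcrit : ((\rank W)%:R = \sum_j t j * (\rank (W *m A j))%:R)%R.

Let S1 := row_base W.
Let S2 := row_base (W^C)%MS.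
Let U1 j := row_base (W *m A j).
Let U2 j := row_base ((W *m A j)^C)%MS.
(** In bases adapted to [W] and to its image, the map is block triangular: [alpha] is the
    restriction to [W], [gamma] the induced map of quotients, and [beta] a shear that translation
    invariance will absorb. *)
Let alpha j := S1 *m A j *m pinvmx (U1 j).
Let bg j := S2 *m A j *m pinvmx (compl_basis (W *m A j)).
Let beta j := lsubmx (bg j).
Let gamma j := rsubmx (bg j).

Let S1A j : S1 *m A j = alpha j *m U1 j.
Proof.
rewrite mulmxKpV// eq_row_base; apply: submxMr.
by rewrite eq_row_base.
Qed.

Let S2A j : (S2 *m A j = beta j *m U1 j + gamma j *m U2 j)%R.
Proof.
rewrite -mul_row_col hsubmxK mulmxKpV//.
by rewrite compl_basis_eq1 submx1.
Qed.

Let cond_alpha : bl_condition alpha t.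
Proof.
split; first exact: Wcrit.
move=> r V; have := condA.2 _ (V *m S1).
rewrite mxrankMfree ?row_base_free// => /le_trans; apply; rewrite le_eqVlt.
apply/orP; left; apply/eqP; apply: eq_bigr => j _; congr (_ * _%:R)%R.
by rewrite -mulmxA S1A mulmxA mxrankMfree// row_base_free.
Qed.

(** A subspace [V] of the quotient lifts to [W + V]. Its image has rank at most that of [W *m A j]
    plus that of [V *m gamma j], and the critical equality for [W] is subtracted. *)
Let cond_gamma : bl_condition gamma t.
Proof.
split.
  apply: (@addrI _ (\rank W)%:R); rewrite -natrD rank_compl_add {1}Wcrit condA.1.
  rewrite -big_split/=; apply: eq_bigr => j _.
  by rewrite -mulrDr -natrD rank_compl_add.
move=> r V; have := condA.2 _ (col_mx S1 (V *m S2)).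
have -> : \rank (col_mx S1 (V *m S2)) = (\rank W + \rank V)%N.
  have -> : col_mx S1 (V *m S2) = block_mx 1%:M 0 0 V *m compl_basis W.
    by rewrite mul_block_col mul1mx !mul0mx addr0 add0r.
  by rewrite mxrankMfree ?compl_basis_free// rank_diag_block_mx mxrank1.
rewrite natrD {1}Wcrit -lerBrDl => /le_trans; apply.
rewrite -sumrB; apply: ler_sum => j _; rewrite -mulrBr ler_wpM2l//.
rewrite lerBlDl -natrD ler_nat mul_col_mx -mulmxA S1A S2A.
have -> : col_mx (alpha j *m U1 j) (V *m (beta j *m U1 j + gamma j *m U2 j)) =
    block_mx (alpha j) 0 (V *m beta j) 1%:M *m col_mx (U1 j) (V *m gamma j *m U2 j).
  by rewrite mul_block_col mul0mx addr0 mul1mx mulmxDr !mulmxA.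
rewrite (leq_trans (mxrankM_maxr _ _))// -addsmxE.
rewrite (leq_trans (mxrank_adds_leqif _ _))// leq_add ?rank_leq_row//.
exact: mxrankM_maxl.
Qed.

Lemma bl_critical :
  (forall nj' (A' : forall j, 'M[R]_(\rank W, nj' j)), bl_condition A' t ->
    bl_bounded A' t) ->
  (forall nj' (A' : forall j, 'M[R]_(\rank (W^C)%MS, nj' j)), bl_condition A' t ->
    bl_bounded A' t) ->
  bl_bounded A t.
Proof.
move=> /(_ _ _ cond_alpha)[C1 C10 H1] /(_ _ _ cond_gamma)[C2 C20 H2].
have [c c0 cE] := lint_compl_basis W.
have cj j := lint_compl_basis (W *m A j).
pose d j := s2val (cid2 (cj j)).
have d0 j : (0 < d j)%R by exact: s2valP (cid2 (cj j)).
have dE j f : measurable_row f -> (forall v, 0 <= f v) ->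
    lint (fun z => lint (fun w => f (w *m U1 j + z *m U2 j)%R)) = (d j)%:E * lint f.
  exact: (s2valP' (cid2 (cj j))).
exists (c^-1 * C2 * C1 * \prod_j (d j `^ t j))%R.
  rewrite !mulr_ge0// ?invr_ge0 ?(ltW c0)//; apply: prodr_ge0 => j _.
  exact: powR_ge0.
move=> g mg g0.
have mF := measurable_row_bl A t mg.
(* The partial integrals along the image of [W] are the input functions for the quotient
   inequality. *)
pose G j (v : 'rV[R]_(\rank ((W *m A j)^C)%MS)) :=
  lint (fun u => g j (u *m U1 j + v *m U2 j)%R).
have mG j : measurable_row (G j).
  pose h (v : 'rV[R]_(\rank ((W *m A j)^C)%MS)) u := g j (u *m U1 j + v *m U2 j)%R.
  have mh := measurable_row_prod_shift (U2 j) (U1 j) (mg j).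
  apply: (measurable_lint (G := fun x => h (row_of x))) => //=.
    by under eq_fun do rewrite /h addrC.
  by move=> x u; exact: g0.
have G0 : forall j v, 0 <= G j v by move=> j v; exact: lint_ge0.
have inner z : lint (fun w => \prod_j (g j ((w *m S1 + z *m S2) *m A j) `^ t j)) <=
    C1%:E * \prod_j (G j (z *m gamma j) `^ t j).
  (* For fixed [z], the slice of [g j] met by the translate of [W]. Its shift by [z *m beta j] does
     not change the integral, which is therefore [G j (z *m gamma j)]. *)
  pose g' j (u : 'rV[R]_(\rank (W *m A j))) :=
    g j ((u + z *m beta j) *m U1 j + (z *m gamma j) *m U2 j)%R.
  have mg' j : measurable_row (g' j).
    have := measurable_row_affine (U1 j)
      (z *m beta j *m U1 j + z *m gamma j *m U2 j)%R (mg j).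
    by rewrite /measurable_row; under eq_fun do rewrite addrA -mulmxDl.
  have -> : \prod_j (G j (z *m gamma j) `^ t j) = \prod_j (lint (g' j) `^ t j).
    apply: eq_bigr => j _; congr (_ `^ _).
    exact/esym/(lint_shift (z *m beta j)
      (measurable_row_affine (U1 j) (z *m gamma j *m U2 j) (mg j))).
  rewrite (eq_lint (G := fun w => \prod_j (g' j (w *m alpha j) `^ t j))).
    by apply: H1 => // j v; exact: g0.
  move=> w; apply: eq_bigr => j _; congr (g j _ `^ _).
  rewrite mulmxDl -(mulmxA w S1) -(mulmxA z S2) S1A S2A mulmxDr addrA.
  by rewrite (mulmxA w) (mulmxA z (beta j)) (mulmxA z (gamma j)) -mulmxDl.
have cV x : x = c^-1%:E * (c%:E * x).
  by rewrite muleA -EFinM mulVf ?mul1e// gt_eqF.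
rewrite [leLHS]cV -(cE _ mF (bl_ge0 A g t)).
rewrite -!mulrA EFinM -muleA lee_pmul ?lee_fin ?invr_ge0 ?(ltW c0)//.
  by apply: lint_ge0 => z; apply: lint_ge0 => w; exact: bl_ge0.
apply: (@le_trans _ _ (lint (fun z => C1%:E * \prod_j (G j (z *m gamma j) `^ t j)))).
  by apply: le_lint => // z; apply: lint_ge0 => w; exact: bl_ge0.
rewrite lintZl//; last 2 first.
- exact: measurable_row_bl.
- by move=> v; exact: bl_ge0.
apply: (@le_trans _ _ (C1%:E * (C2%:E * \prod_j (lint (G j) `^ t j)))).
  by rewrite lee_pmul// ?lee_fin ?lint_ge0//; [move=> v; exact: bl_ge0|exact: H2].
rewrite muleA -EFinM (mulrC C1) mulrA [X in _ <= X * _]EFinM -muleA.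
rewrite lee_pmul ?lee_fin ?mulr_ge0//.
  by apply: prode_ge0 => j _; exact: poweR_ge0.
rewrite -prode_EFin -big_split/= le_eqVlt; apply/orP; left; apply/eqP.
apply: eq_bigr => j _; rewrite -poweR_EFin -poweRM ?lint_ge0 ?lee_fin ?(ltW (d0 j))//.
by rewrite -dE.
Qed.

End critical.

End BrascampLieb.

(** * Moving the exponents to a boundary point, and the induction *)

Section BoundaryPoint.
Context {R : realType}.
Local Open Scope ring_scope.

(** A first zero, capped by [delta], of finitely many affine functions positive at 0. In the
    induction, a new constraint violated at [s] is decreasing, so its own zero comes earlier, and
    the other constraints still hold there. *)
Lemma first_tight (I : eqType) (l : seq I) (a b : I -> R) (delta : R) :
  0 < delta -> (forall i, i \in l -> 0 < a i) ->
  exists s, [/\ 0 < s, s <= delta,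
    forall i, i \in l -> 0 <= a i + s * b i &
    s = delta \/ exists2 i, i \in l & a i + s * b i = 0].
Proof.
move=> d0; elim: l => [|i l IH] al.
  by exists delta; split => //; left.
have [|s [s0 sd hs tight]] := IH; first by move=> j jl; rewrite al// inE jl orbT.
have ai0 : 0 < a i by rewrite al// mem_head.
have [ok|bad] := leP 0 (a i + s * b i).
  exists s; split => //.
    by move=> j; rewrite inE => /orP[/eqP->//|]; exact: hs.
  by case: tight => [|[j jl jE]]; [left|right; exists j => //; rewrite inE jl orbT].
have bi0 : b i < 0.
  rewrite ltNge; apply/negP => bi; have := mulr_ge0 (ltW s0) bi; lra.
have s'0 : 0 < a i / - b i by rewrite divr_gt0// oppr_gt0.
have s's : a i / - b i < s by rewrite ltr_pdivrMr ?oppr_gt0//; lra.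
have s'E : a i + a i / - b i * b i = 0.
  by rewrite invrN mulrN mulNr -mulrA mulVf ?mulr1 ?subrr// lt_eqF.
exists (a i / - b i); split => //; first by lra.
  move=> j; rewrite inE => /orP[/eqP->|jl]; first by rewrite s'E.
  have aj : 0 < a j by rewrite al// inE jl orbT.
  have [bj|bj] := leP 0 (b j); first exact: addr_ge0 (ltW aj) (mulr_ge0 (ltW s'0) bj).
  rewrite (le_trans (hs _ jl))// lerD2l.
  by rewrite ler_wnM2r// ltW.
by right; exists i => //; rewrite mem_head.
Qed.

Section data.
Variables (m n : nat) (nj : 'I_m -> nat) (A : forall j, 'M[R]_(n, nj j)).

Definition has_critical (t : 'I_m -> R) := exists q (W : 'M[R]_(q, n)),
  [/\ (0 < \rank W)%N, (\rank W < n)%N &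
    (\rank W)%:R = \sum_j t j * (\rank (W *m A j))%:R].

(** Comparing the condition on the whole space with the scaling equality, nonnegative terms
    [t i * (nj i - \rank (A i))] have a nonpositive sum, so each vanishes. *)
Lemma bl_condition_rank (t : 'I_m -> R) : (forall j, 0 <= t j) ->
  bl_condition A t -> forall j, 0 < t j -> \rank (A j) = nj j.
Proof.
move=> t0 [nE cond] j tj0; have := cond _ 1%:M; rewrite mxrank1 nE.
under [X in _ <= X]eq_bigr do rewrite mul1mx.
rewrite -subr_le0 -sumrB => h.
have hge i : 0 <= t i * (nj i)%:R - t i * (\rank (A i))%:R.
  by rewrite -mulrBr mulr_ge0// subr_ge0 ler_nat rank_leq_col.
have /eqP : \sum_i (t i * (nj i)%:R - t i * (\rank (A i))%:R) = 0.
  by apply/eqP; rewrite eq_le h sumr_ge0.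
rewrite psumr_eq0// => /allP/(_ j (mem_index_enum _)); rewrite implyTb.
by rewrite -mulrBr mulf_eq0 gt_eqF//= subr_eq0 eqr_nat => /eqP.
Qed.

(** For [c = nj] with [nj i] and [nj j] positive the correction is zero, so this direction keeps the
    scaling equality; for ranks it makes every constraint affine in [s]. *)
Lemma sum_perturb (t : 'I_m -> R) (s : R) i j (c : 'I_m -> R) : i != j ->
  \sum_k (t k + s * ((k == i)%:R / (nj i)%:R - (k == j)%:R / (nj j)%:R)) * c k =
  \sum_k t k * c k + s * (c i / (nj i)%:R - c j / (nj j)%:R).
Proof.
move=> ij; under eq_bigr do rewrite mulrDl -mulrA.
rewrite big_split/= -mulr_sumr; congr (_ + s * _).
under eq_bigr do rewrite mulrBl.
rewrite sumrB; congr (_ - _).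
  rewrite (bigD1 i)//= eqxx mul1r big1 ?addr0 ?(mulrC _ (c i))// => k /negPf ->.
  by rewrite !mul0r.
rewrite (bigD1 j)//= eqxx mul1r big1 ?addr0 ?(mulrC _ (c j))// => k /negPf ->.
by rewrite !mul0r.
Qed.

(* [t' i <= 1] needs no separate constraint: it follows from the condition on
   [kermx (A i)], which becomes critical when [t' i = 1]. *)
Lemma bl_boundary (t : 'I_m -> R) i j : (forall k, 0 <= t k) ->
  bl_condition A t -> ~ has_critical t -> i != j ->
  0 < t i -> (0 < nj i)%N -> 0 < t j -> (0 < nj j)%N ->
  exists2 s, 0 < s &
    let t' k := t k + s * ((k == i)%:R / (nj i)%:R - (k == j)%:R / (nj j)%:R) in
    [/\ forall k, 0 <= t' k, bl_condition A t' & t' j = 0 \/ has_critical t'].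
Proof.
move=> t0 condt nocrit ij ti0 ni0 tj0 nj0.
have nir : 0 < (nj i)%:R :> R by rewrite ltr0n.
have njr : 0 < (nj j)%:R :> R by rewrite ltr0n.
(* Only finitely many constraints occur: they depend on ranks alone. *)
pose prof := ('I_n.+1 * {ffun 'I_m -> 'I_n.+1})%type.
pose a (x : prof) : R := \sum_k t k * (x.2 k)%:R - (x.1)%:R.
pose b (x : prof) : R := (x.2 i)%:R / (nj i)%:R - (x.2 j)%:R / (nj j)%:R.
pose ok (x : prof) := `[< exists q (W : 'M[R]_(q, n)),
  [/\ (0 < \rank W)%N, (\rank W < n)%N, \rank W = x.1 &
    forall k, \rank (W *m A k) = x.2 k] >].
(* The cap is the value of [s] at which the exponent of [j] reaches zero; stopping earlier means
   that some subspace has become critical. *)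
have [|x|s [s0 sd hs tight]] := @first_tight _ [seq x <- enum {: prof} | ok x] a b
    (t j * (nj j)%:R).
- by rewrite mulr_gt0.
- rewrite mem_filter => /andP[/asboolP[q [W [W0 Wn W1 W2]]] _].
  rewrite /a subr_gt0 lt_neqAle -W1; under eq_bigr do rewrite -W2.
  rewrite condt.2 andbT; apply/eqP => WE; apply: nocrit.
  by exists q, W.
have pert q (W : 'M[R]_(q, n)) : (0 < \rank W)%N -> (\rank W < n)%N ->
    0 <= \sum_k t k * (\rank (W *m A k))%:R - (\rank W)%:R +
      s * ((\rank (W *m A i))%:R / (nj i)%:R - (\rank (W *m A j))%:R / (nj j)%:R).
  move=> W0 Wn; have bnd k : (\rank (W *m A k) < n.+1)%N.
    by rewrite ltnS (leq_trans (mxrankM_maxl _ _)) ?rank_leq_col.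
  pose x : prof := (inord (\rank W), [ffun k => inord (\rank (W *m A k))]).
  have := hs x; rewrite mem_filter mem_enum andbT /a /b /=.
  have x2 k : x.2 k = \rank (W *m A k) :> nat by rewrite ffunE inordK.
  have x1 : x.1 = \rank W :> nat by rewrite inordK// ltnS ltnW.
  rewrite x1 !x2; under eq_bigr do rewrite x2.
  by apply; apply/asboolP; exists q, W; split.
exists s => // t'; split.
- move=> k; rewrite /t'; have [->|kj] := eqVneq k j.
    rewrite eq_sym (negbTE ij) mul0r sub0r mul1r mulrN subr_ge0.
    by rewrite ler_pdivrMr.
  by rewrite mul0r subr0 addr_ge0// mulr_ge0 ?divr_ge0// ltW.
- split.
    by rewrite sum_perturb// !divff ?gt_eqF// subrr mulr0 addr0 condt.1.
  move=> q W; rewrite sum_perturb//.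
  have [W0|W0] := posnP (\rank W).
    have W00 : W = 0 by apply/eqP; rewrite -mxrank_eq0 W0.
    rewrite W00 !mxrank0; under eq_bigr do rewrite mul0mx mxrank0 mulr0.
    by rewrite !mul0mx !mxrank0 !mul0r subrr mulr0 big1// addr0.
  have [Wn|Wn] := ltnP (\rank W) n; first by have := pert q W W0 Wn; lra.
  (* On the whole space the ranks at [i] and [j] are full, so the perturbation cancels. *)
  have Wfull : (W :=: 1%:M)%MS.
    by apply/eqmxP; rewrite submx1/= sub1mx /row_full eqn_leq rank_leq_col.
  have WA k : \rank (W *m A k) = \rank (A k).
    by rewrite (eqmxMr _ Wfull) mul1mx.
  rewrite (WA i) (WA j) !(bl_condition_rank t0 condt)// !divff ?gt_eqF//.
  by rewrite subrr mulr0 addr0 condt.2.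
- case: tight => [sE|[x]].
    left; rewrite /t' eqxx eq_sym (negbTE ij) mul0r sub0r mul1r sE mulrN.
    by rewrite mulfK ?subrr// gt_eqF.
  rewrite mem_filter => /andP[/asboolP[q [W [W0 Wn W1 W2]]] _] xE.
  right; exists q, W; split => //; rewrite sum_perturb//; move: xE.
  rewrite /a /b -W1 -!W2; under eq_bigr do rewrite -W2.
  lra.
Qed.

(** The measure of the inner induction. Target spaces of dimension zero, which arise from
    restrictions and quotients, are not counted. *)
Definition bl_active (t : 'I_m -> R) := #|[set j | (0 < t j) && (0 < nj j)%N]%SET|.

End data.

Lemma bl_sufficient m n (nj : 'I_m -> nat) (A : forall j, 'M[R]_(n, nj j)) t :
  (0 < n)%N -> (forall j, 0 <= t j) -> bl_condition A t -> bl_bounded A t.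
Proof.
elim/ltn_ind: n => n IHn in nj A t *; move=> n0.
have [k] := ubnP (bl_active nj t); elim: k t => // k IHk t; rewrite ltnS => tk.
move=> t0 condt.
have crit t' : (forall j, 0 <= t' j) -> bl_condition A t' -> has_critical A t' ->
    bl_bounded A t'.
  move=> t'0 condt' [q [W [W0 Wn WE]]].
  apply: (bl_critical t'0 condt' WE) => nj' A'.
    by apply: IHn.
  by apply: IHn => //; rewrite mxrank_compl ?subn_gt0// ltn_subrL W0.
have [|nocrit] := pselect (has_critical A t); first exact: crit.
have [/card_gt1P[i [j [iP jP ij]]]|act1] := ltnP 1 (bl_active nj t).
  move: iP jP; rewrite !inE => /andP[ti0 ni0] /andP[tj0 nj0].
  (* An end point of the segment: either a critical subspace has appeared, or the exponent of [v]
     has vanished and the active set has shrunk. *)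
  have half t' u v : (0 < t v) -> (forall x, 0 <= t' x) -> bl_condition A t' ->
      (0 < nj v)%N -> (forall x, x != u -> x != v -> t' x = t x) -> 0 < t u ->
      t' v = 0 \/ has_critical A t' -> bl_bounded A t'.
    move=> tv0 t'0 condt' nv0 t'E tu0 [t'v|]; last exact: crit.
    apply: IHk => //; rewrite (leq_trans _ tk)//.
    apply/proper_card/properP; split.
      apply/fintype.subsetP => x; rewrite !inE => /andP[t'x ->]; rewrite andbT.
      have [->//|xu] := eqVneq x u; have [->//|xv] := eqVneq x v.
      by rewrite -t'E.
    by exists v; rewrite !inE ?tv0// t'v ltxx.
  have [s1 s10 [t10 cond1 end1]] := bl_boundary t0 condt nocrit ij ti0 ni0 tj0 nj0.
  have [|s2 s20 [t20 cond2 end2]] :=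
    bl_boundary t0 condt nocrit _ tj0 nj0 ti0 ni0; first by rewrite eq_sym.
  set t1 := (fun k => _) in t10 cond1 end1; set t2 := (fun k => _) in t20 cond2 end2.
  have b1 : bl_bounded A t1.
    apply: (half t1 i j) => // x /negbTE xi /negbTE xj.
    by rewrite /t1 xi xj !mul0r subrr mulr0 addr0.
  have b2 : bl_bounded A t2.
    apply: (half t2 j i) => // x /negbTE xj /negbTE xi.
    by rewrite /t2 xi xj !mul0r subrr mulr0 addr0.
  have s12 : 0 < s1 + s2 by rewrite addr_gt0.
  (* The displacements [s1] and [- s2] along the same direction cancel with weights [s2 / (s1 + s2)]
     and [s1 / (s1 + s2)]. *)
  have := @bl_interpolation _ _ _ _ A t1 t2 (s1 / (s1 + s2)) t10 t20 _ b1 b2.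
  rewrite divr_gt0//= ltr_pdivrMr// mul1r ltrDl s20 => /(_ isT).
  congr bl_bounded; apply/funext => x; rewrite /t1 /t2.
  set y := (_ / _ - _)%R; rewrite -[X in _ + s2 * X]opprB -/y.
  by field; rewrite gt_eqF.
have : bl_active nj t != 0%N.
  apply/eqP => act0; have := condt.1; rewrite big1 => [/eqP|j _].
    by rewrite pnatr_eq0 -leqn0 leqNgt n0.
  have /eqP := act0; rewrite cards_eq0 => /eqP/setP/(_ j).
  rewrite !inE => /negbT; rewrite negb_and -leNgt -leqNgt leqn0 => /orP[tj|/eqP->].
    by rewrite (_ : t j = 0) ?mul0r//; apply/eqP; rewrite eq_le t0 tj.
  by rewrite mulr0.
move: act1; rewrite leq_eqVlt ltnS leqn0 => /orP[/cards1P[j0 act] _|->//].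
have : j0 \in [set j | (0 < t j) && (0 < nj j)%N]%SET by rewrite act set11.
rewrite inE => /andP[tj0 nj0].
have tj j : j != j0 -> t j = 0 \/ nj j = 0%N.
  move=> jj0; have : j \notin [set j | (0 < t j) && (0 < nj j)%N]%SET.
    by rewrite act inE.
  rewrite inE negb_and -leNgt -leqNgt leqn0 => /orP[h|/eqP]; last by right.
  by left; apply/eqP; rewrite eq_le h t0.
have rA : \rank (A j0) = nj j0 by exact: bl_condition_rank condt _ tj0.
(* The kernel of [A j0] has image zero at the only active index, so the condition bounds its
   dimension by 0. *)
have freeA : row_free (A j0).
  rewrite -kermx_eq0 -mxrank_eq0 -leqn0 -(ler_nat R).
  rewrite (le_trans (condt.2 _ (kermx (A j0))))// big1// => j _.
  have [->|jj0] := eqVneq j j0; first by rewrite mulmx_ker mxrank0 mulr0.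
  have [->|nj00] := tj j jj0; first by rewrite mul0r.
  rewrite (_ : \rank _ = 0%N) ?mulr0//; apply/eqP; rewrite -leqn0 -nj00.
  exact: rank_leq_col.
have nE : nj j0 = n by rewrite -rA; exact/eqP.
apply: (@bl_invertible _ _ _ _ A t j0 (pinvmx (A j0))) => //.
- have := condt.1; rewrite (bigD1 j0)//= big1 ?addr0; last first.
    by move=> j /tj[->|->]; rewrite ?mul0r ?mulr0.
  rewrite nE -{1}[n%:R]mul1r => /mulIf <-//.
  by rewrite pnatr_eq0 -lt0n.
- by rewrite -[X in X *m _]mul1mx mulmxKpV// sub1mx /row_full rA.
- exact: mulmxVp.
Qed.

End BoundaryPoint.

(** * Necessity *)

Section Necessity.
Context {R : realType}.

(** If [b < a], the [r] with [r] to the power [a - b] equal to [Num.max K 1 + 1] violates the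
    bound. *)
Lemma powR_growth_le (a b K : R) :
  (forall r : R, 1 <= r -> r `^ a <= K * r `^ b)%R -> (a <= b)%R.
Proof.
move=> h; rewrite leNgt; apply/negP => ba.
have ab : (0 < a - b)%R by rewrite subr_gt0.
pose k := Num.max K 1%R.
have k1 : (1 <= k)%R by rewrite le_max lexx orbT.
pose r := ((k + 1) `^ (a - b)^-1)%R.
have r1 : (1 <= r)%R.
  rewrite (_ : 1%R = 1 `^ (a - b)^-1)%R; last by rewrite powR1.
  by rewrite ge0_ler_powR ?nnegrE ?invr_ge0 ?(ltW ab)//; lra.
have rE : (r `^ (a - b) = k + 1)%R.
  by rewrite -powRrM mulVf ?gt_eqF// powRr1//; lra.
have rb : (0 < r `^ b)%R by rewrite powR_gt0; lra.
have := h _ r1; rewrite -{1}(subrK b a) powRD; last first.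
  by apply/implyP => _; rewrite gt_eqF// (lt_le_trans ltr01).
rewrite ler_pM2r// rE.
have : (K <= k)%R by rewrite le_max lexx.
lra.
Qed.

Lemma prod_poweR_growth m (kappa : 'I_m -> R) (k : 'I_m -> nat) (t : 'I_m -> R) r :
  (forall j, 0 <= kappa j)%R -> (0 < r)%R ->
  \prod_j ((kappa j * r ^+ k j)%:E `^ t j) =
  ((\prod_j kappa j `^ t j) * r `^ (\sum_j t j * (k j)%:R))%R%:E.
Proof.
move=> kappa0 r0.
rewrite (eq_bigr (fun j => ((kappa j * r ^+ k j) `^ t j)%R%:E))// prode_EFin; congr EFin.
rewrite (big_morph (fun x => r `^ x)%R (id1 := 1%R) (op1 := *%R)); last 2 first.
- by move=> x y; rewrite powRD// implybE (gt_eqF r0) orbT.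
- by rewrite powRr0.
rewrite -big_split/=; apply: eq_bigr => j _.
rewrite powRM ?exprn_ge0 ?(ltW r0)// mulrC (mulrC (t j)) powRrM.
by rewrite powR_mulrn ?ltW// mulrC.
Qed.

Section data.
Variables (m n : nat) (nj : 'I_m -> nat) (A : forall j, 'M[R]_(n, nj j)).
Variables (t : 'I_m -> R) (C : R).
(** The left side carries no exponents: a factor with [t j = 0] must remain an indicator, as it does
    in the original inequality for [p j = +oo], and not become the constant 1. *)
Hypothesis bl_indic : forall b : forall j, 'rV[R]_(nj j) -> bool,
  (forall j, measurable_row (fun v => (b j v)%:R%:E)) ->
  (forall j, 0 < lint (fun v => (b j v)%:R%:E : \bar R) < +oo) ->
  lint (fun x => \prod_j (b j (x *m A j))%:R%:E) <=
  C%:E * \prod_j (lint (fun v => (b j v)%:R%:E) `^ t j).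

Lemma bl_scaling (r : R) : (0 < r)%R ->
  (r ^+ n <= (C * (\prod_j ((2 * (mx_l1 (A j) + 1)) ^+ nj j) `^ t j)) / 2 ^+ n *
     r `^ (\sum_j t j * (nj j)%:R))%R.
Proof.
move=> r0; have l1 j : (0 < mx_l1 (A j) + 1)%R by rewrite ltr_wpDl// mx_l1_ge0.
(* These cubes contain the image of the cube of radius [r]; the added 1 keeps their volume positive
   even when [A j = 0]. *)
pose b j (v : 'rV[R]_(nj j)) :=
  [forall i, (`|v ord0 i| <= r * (mx_l1 (A j) + 1))%R].
have bE j : (fun v => (b j v)%:R%:E) = cube (r * (mx_l1 (A j) + 1)).
  by apply/funext => v; rewrite cubeE.
have lb j : lint (fun v => (b j v)%:R%:E) =
    ((2 * (mx_l1 (A j) + 1)) ^+ nj j * r ^+ nj j)%:E.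
  rewrite bE lint_cube ?mulr_ge0 ?(ltW r0) ?(ltW (l1 j))//.
  by rewrite -exprMn -mulrA (mulrC r).
have := @bl_indic b.
under [X in _ -> _ -> _ <= _ * X]eq_bigr do rewrite lb.
rewrite prod_poweR_growth//; last first.
  by move=> j; rewrite exprn_ge0// mulr_ge0// ltW.
move=> h; have {h} : lint (@cube R n r) <= C%:E * ((\prod_j
    ((2 * (mx_l1 (A j) + 1)) ^+ nj j) `^ t j) * r `^ (\sum_j t j * (nj j)%:R))%R%:E.
  apply: (le_trans _ (h _ _)).
  - apply: le_lint => x; first exact: cube_ge0.
    rewrite prode_EFin cubeE lee_fin.
    case: (boolP [forall _, _]) => [/forallP xr|_]; last exact: prodr_ge0.
    rewrite big1// => j _; rewrite /b (_ : [forall _, _])//.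
    apply/forallP => i; rewrite (le_trans (coord_mulmx_le _ _ xr))//.
    by rewrite ler_pM2l// lerDl.
  - by move=> j; rewrite bE; exact: measurable_cube.
  - move=> j; rewrite lb lte_fin ltry andbT mulr_gt0 ?exprn_gt0//.
    by rewrite mulr_gt0.
rewrite lint_cube ?(ltW r0)// -EFinM lee_fin exprMn => h.
rewrite mulrAC ler_pdivlMr ?exprn_gt0// mulrC (le_trans h)//.
by rewrite mulrA.
Qed.

Lemma bl_scaling_dim : (n%:R = \sum_j t j * (nj j)%:R)%R.
Proof.
apply/eqP; rewrite eq_le; apply/andP; split.
  apply: powR_growth_le => r r1; rewrite powR_mulrn; last lra.
  by apply: bl_scaling; lra.
(* Small cubes, of radius [r^-1], give the reverse inequality. *)
rewrite -lerN2; apply: powR_growth_le => r r1.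
have r0 : (0 < r)%R by lra.
have := @bl_scaling r^-1%R; rewrite invr_gt0 => /(_ r0).
rewrite -powR_mulrn ?invr_ge0 ?(ltW r0)// -powR_inv1 ?(ltW r0)// -!powRrM.
by rewrite !mulN1r => h; exact: h.
Qed.

Lemma bl_subspace q (W : 'M[R]_(q, n)) :
  ((\rank W)%:R <= \sum_j t j * (\rank (W *m A j))%:R)%R.
Proof.
have [c c0 cE] := lint_compl_basis W.
have cj j := lint_compl_basis (W *m A j).
pose d j := s2val (cid2 (cj j)).
have d0 j : (0 < d j)%R by exact: s2valP (cid2 (cj j)).
have dE j f : measurable_row f -> (forall v, 0 <= f v) ->
    lint (fun z => lint (fun w => f (w *m row_base (W *m A j) +
      z *m row_base ((W *m A j)^C)%MS)%R)) = (d j)%:E * lint f.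
  exact: (s2valP' (cid2 (cj j))).
pose k j := \rank (W *m A j); pose l j := \rank ((W *m A j)^C)%MS.
pose P j : 'M[R]_(nj j, k j + l j)%N := pinvmx (compl_basis (W *m A j)).
pose M1 j := row_base W *m A j *m P j.
pose M2 j := row_base (W^C)%MS *m A j *m P j.
pose e j := (mx_l1 (M1 j) + mx_l1 (M2 j) + 1)%R.
have e0 j : (0 < e j)%R by rewrite ltr_wpDl// addr_ge0// mx_l1_ge0.
(* The image of [W] has no component across itself, so the boxes [b j] may stay bounded in the
   complementary directions. *)
have M1r j : rsubmx (M1 j) = 0%R.
  have /submxP[D DE] : (row_base W *m A j <= row_base (W *m A j))%MS.
    by rewrite eq_row_base; apply: submxMr; rewrite eq_row_base.
  rewrite /M1 DE (_ : row_base (W *m A j) = row_mx 1%:M 0 *m compl_basis (W *m A j)).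
    by rewrite -!mulmxA compl_basisK mulmx1 mul_mx_row row_mxKr mulmx0.
  by rewrite mul_row_col mul1mx mul0mx addr0.
(* The volume of the box [b j] with the power of [r] removed; [d j] is the Jacobian of the adapted
   basis. *)
pose kappa j := ((d j)^-1 * (2 * e j) ^+ l j * (2 * e j) ^+ k j)%R.
have kappa0 j : (0 < kappa j)%R.
  by rewrite /kappa !mulr_gt0 ?exprn_gt0 ?mulr_gt0// invr_gt0.
pose K := (c * (C * \prod_j kappa j `^ t j) / (2 ^+ \rank (W^C)%MS * 2 ^+ \rank W))%R.
apply: (@powR_growth_le _ _ K) => r r1; have r0 : (0 < r)%R by lra.
rewrite powR_mulrn ?(ltW r0)//.
pose b j (v : 'rV[R]_(nj j)) :=
  [forall i, (`|lsubmx (v *m P j) ord0 i| <= r * e j)%R] &&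
  [forall i, (`|rsubmx (v *m P j) ord0 i| <= e j)%R].
have bE j v : (b j v)%:R%:E =
    cube (r * e j) (lsubmx (v *m P j)) * cube (e j) (rsubmx (v *m P j)).
  by rewrite !cubeE -EFinM -natrM mulnb.
have mb j : measurable_row (fun v => (b j v)%:R%:E).
  rewrite /measurable_row; under eq_fun do rewrite bE.
  have mP : measurable_to_row (fun x : (nj j).-tuple (measurableTypeR R) =>
      row_of x *m P j).
    by apply: measurable_to_rowM; exact: measurable_row_of.
  apply: emeasurable_funM.
    apply: (measurable_row_comp (F := cube (r * e j))
      (phi := fun x => lsubmx (row_of x *m P j))); first exact: measurable_cube.
    by move=> i; under eq_fun do rewrite mxE; exact: mP.
  apply: (measurable_row_comp (F := cube (e j))
    (phi := fun x => rsubmx (row_of x *m P j))); first exact: measurable_cube.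
  by move=> i; under eq_fun do rewrite mxE; exact: mP.
have lb j : lint (fun v => (b j v)%:R%:E) = (kappa j * r ^+ k j)%:E.
  have := dE j _ (mb j) (fun=> _); rewrite -/(k j) -/(l j) => dEj.
  have {dEj} : (d j)%:E * lint (fun v => (b j v)%:R%:E) =
      ((2 * e j) ^+ l j * (2 * (r * e j)) ^+ k j)%:E.
    rewrite -dEj; last by move=> v; rewrite lee_fin.
    transitivity (lint (fun z : 'rV[R]_(l j) => cube (e j) z *
        lint (fun w : 'rV[R]_(k j) => cube (r * e j) w))).
      apply: eq_lint => z; rewrite -lintZl ?cube_ge0//; last 2 first.
      - exact: measurable_cube.
      - exact: cube_ge0.
      apply: eq_lint => w; rewrite bE -mul_row_col -mulmxA compl_basisK mulmx1.
      by rewrite row_mxKl row_mxKr muleC.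
    rewrite lintZr ?lint_ge0//; [|exact: measurable_cube|exact: cube_ge0|exact: cube_ge0].
    by rewrite !lint_cube ?mulr_ge0 ?(ltW r0) ?(ltW (e0 j)).
  move=> /(congr1 (fun x => (d j)^-1%:E * x)).
  rewrite muleA -EFinM mulVf ?gt_eqF// mul1e => ->.
  rewrite -EFinM /kappa (_ : 2 * (r * e j) = 2 * e j * r)%R; last first.
    by rewrite (mulrC r) mulrA.
  by rewrite [((2 * e j * r) ^+ _)%R]exprMn !mulrA.
have := @bl_indic b mb; under [X in _ -> _ <= _ * X]eq_bigr do rewrite lb.
rewrite prod_poweR_growth//; last by move=> j; exact: ltW.
move=> h.
have {h} : c%:E * lint (fun x => \prod_j (b j (x *m A j))%:R%:E) <=
    c%:E * (C%:E * ((\prod_j kappa j `^ t j) *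
      r `^ (\sum_j t j * (k j)%:R))%R%:E).
  rewrite lee_pmul2l// ?fin_numE//; apply: h => j.
  by rewrite lb lte_fin ltry andbT mulr_gt0// exprn_gt0.
rewrite -cE; last 2 first.
- have := measurable_row_bl A (fun=> 1%R) mb; congr measurable_row.
  by apply/funext => x; apply: eq_bigr => j _; rewrite poweRe1 ?lee_fin.
- by move=> v; apply: prode_ge0 => j _; rewrite lee_fin.
(* The box of radius [r] along [W] and 1 along its complement is mapped into every [b j]. *)
move=> h; have {h} : lint (fun z : 'rV[R]_(\rank (W^C)%MS) => cube 1 z *
    lint (fun w : 'rV[R]_(\rank W) => cube r w)) <= c%:E * (C%:E *
      ((\prod_j kappa j `^ t j) * r `^ (\sum_j t j * (k j)%:R))%R%:E).
  apply: (le_trans _ h); apply: le_lint => z.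
    by rewrite mule_ge0 ?cube_ge0// lint_ge0// => w; exact: cube_ge0.
  rewrite -lintZl ?cube_ge0//; [|exact: measurable_cube|exact: cube_ge0].
  apply: le_lint => w; first by rewrite mule_ge0 ?cube_ge0.
  rewrite prode_EFin !cubeE -EFinM lee_fin -natrM mulnb.
  case: (boolP (_ && _)) => [|_]; last by apply: prodr_ge0.
  move=> /andP[/forallP z1 /forallP w1]; rewrite big1// => j _.
  have yE : ((w *m row_base W + z *m row_base (W^C)%MS) *m A j *m P j =
      w *m M1 j + z *m M2 j)%R by rewrite !mulmxDl /M1 /M2 !mulmxA.
  have M2b i : (`|(z *m M2 j) ord0 i| <= mx_l1 (M2 j))%R.
    by rewrite -[leRHS]mul1r; exact: coord_mulmx_le.
  have -> : b j ((w *m row_base W + z *m row_base (W^C)%MS) *m A j) => //.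
  apply/andP; rewrite yE; split; apply/forallP => i.
    rewrite mxE mxE (le_trans (ler_normD _ _))//.
    rewrite (le_trans (lerD (coord_mulmx_le _ _ w1) (M2b _)))//.
    (* Here [1 <= r] absorbs the contribution of the bounded variable [z]. *)
    rewrite /e 2!mulrDr mulr1 -addrA lerD2l.
    have := mx_l1_ge0 (M2 j) => l20; nra.
  rewrite linearD/= -mulmx_rsub M1r mulmx0 add0r mxE.
  rewrite (le_trans (M2b _))// /e -addrA addrCA lerDl addr_ge0//.
  exact: mx_l1_ge0.
rewrite lintZr ?lint_ge0//; [|exact: measurable_cube|exact: cube_ge0|exact: cube_ge0].
rewrite !lint_cube ?(ltW r0)// -!EFinM lee_fin mulr1 exprMn => h.
rewrite /K mulrAC ler_pdivlMr ?mulr_gt0 ?exprn_gt0//.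
by rewrite mulrC -mulrA (le_trans h)// !mulrA.
Qed.

Lemma bl_necessary : bl_condition A t.
Proof. by split; [exact: bl_scaling_dim|move=> q W; exact: bl_subspace]. Qed.

End data.

End Necessity.

(** * Transfer to Hilbert spaces *)

Section SpanRank.
Import VectorInternalTheory.
Context {F : fieldType} {vT : vectType F}.
Local Open Scope ring_scope.
Variable e : (\dim {:vT}).-tuple vT.
Hypothesis e_basis : basis_of {:vT} e.

(** The dimension is a rank in the internal coordinates [v2r]; passing to the basis [e] multiplies
    by a row-free matrix, since [f2] undoes [f1]. *)
Lemma dim_span_rVof k (X : k.-tuple vT) :
  \dim <<X>>%VS = \rank (\matrix_(i < k) passmx.rVof e (tnth X i)).
Proof.
have -> : \dim <<X>>%VS = \rank (b2mx X).
  case: X => X i; move: (eqP i) => sX; subst k.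
  by rewrite /dimv [span]unlock mx2vsK (eq_irrelevance i (eqxx _)).
pose g1 (u : 'rV[F]_(dim vT)) := passmx.rVof e (r2v u).
have lg1 : linear g1.
  move=> a u v; rewrite /g1 linearD linearZ; exact: passmx.rVof_linear.
pose f1 : {linear 'rV[F]_(dim vT) -> 'rV[F]_(\dim {:vT})} :=
  HB.pack g1 (GRing.isLinear.Build _ _ _ _ g1 lg1).
pose g2 (u : 'rV[F]_(\dim {:vT})) := v2r (passmx.vecof e u).
have lg2 : linear g2.
  by move=> a u v; rewrite /g2 passmx.vecof_linear linearD linearZ.
pose f2 : {linear 'rV[F]_(\dim {:vT}) -> 'rV[F]_(dim vT)} :=
  HB.pack g2 (GRing.isLinear.Build _ _ _ _ g2 lg2).
have T12 : lin1_mx f1 *m lin1_mx f2 = 1%:M.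
  apply/row_matrixP => i; rewrite !rowE mulmx1 mulmxA !mul_rV_lin1/=.
  by rewrite /g2 /g1 passmx.rVofK// r2vK.
have -> : \matrix_(i < k) passmx.rVof e (tnth X i) = b2mx X *m lin1_mx f1.
  by apply/row_matrixP => i; rewrite row_mul !rowK mul_rV_lin1/= /g1 v2rK.
apply/esym; rewrite mxrankMfree//; apply/row_freeP; by exists (lin1_mx f2).
Qed.
End SpanRank.

Section Coordinates.
Context {R : realType} (H : hilbertType R).
Local Notation n := (\dim {:H}).
Local Notation RB := (measurableTypeR R).

Lemma orthonormal_nth (s : seq H) i j : orthonormal (@inner R H) s ->
  (i < size s)%N -> (j < size s)%N -> inner s`_i s`_j = (i == j)%:R%R.
Proof.
elim: s i j => // x s IH i j /andP[/= /andP[/eqP x1 s1] /andP[xs ps]].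
have xs0 k : (k < size s)%N -> inner x s`_k = 0%R.
  move=> ks; move: xs; rewrite /= andbT => /allP/(_ s`_k (mem_nth _ ks)).
  by move=> /eqP.
case: i j => [|i] [|j]//=; rewrite ltnS.
- by move=> _; rewrite ltnS => /xs0.
- by move=> /xs0 xi _; apply/eqP; rewrite herm_eq0C; apply/eqP.
- by rewrite ltnS => *; rewrite IH// /orthonormal s1.
Qed.

Lemma inner_onb (i j : 'I_n) : inner (onb H)`_i (onb H)`_j = (i == j)%:R%R.
Proof.
by apply: orthonormal_nth; rewrite ?size_tuple// /onb; case: cid.
Qed.

Lemma inner_sum_onb (k : 'I_n -> R) (j : 'I_n) :
  inner (\sum_i k i *: (onb H)`_i)%R (onb H)`_j = k j.
Proof.
rewrite linear_sumlz/= (bigD1 j)//= linearZl_LR/= inner_onb eqxx mulr1.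
by rewrite big1 ?addr0// => i ij; rewrite linearZl_LR/= inner_onb (negbTE ij) mulr0.
Qed.

Lemma onb_basis : basis_of {:H} (onb H).
Proof.
rewrite basisEfree subvf size_tuple leqnn !andbT.
apply/freeP => k k0 i; rewrite -(inner_sum_onb k i) k0.
exact: linear0l.
Qed.

Definition coord_row (x : H) : 'rV[R]_n := row_of (onb_coord x).

Lemma coord_rowE x : coord_row x = passmx.rVof (onb H) x.
Proof.
apply/rowP => i; rewrite !mxE tnth_mktuple (tnth_nth 0%R).
by rewrite {1}(coord_basis onb_basis (memvf x)) inner_sum_onb.
Qed.

Lemma onb_coordE x : onb_coord x = tuple_of_row (coord_row x).
Proof. by rewrite row_ofK. Qed.

Lemma onb_coord_bij : bijective (onb_coord : H -> n.-tuple RB).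
Proof.
exists (fun t => passmx.vecof (onb H) (row_of t)) => t.
  by rewrite -/(coord_row t) coord_rowE passmx.rVofK//; exact: onb_basis.
by rewrite onb_coordE coord_rowE passmx.vecofK ?row_ofK//; exact: onb_basis.
Qed.

(** Borel sets are Caratheodory measurable for the outer measure on tuples, and the bijection
    [onb_coord] transports the splitting identity to [H]. *)
Lemma measurable_onb_coord :
  measurable_fun setT (onb_coord : lebesgueType H -> n.-tuple RB).
Proof.
move=> _ B mB; rewrite setTI.
have cB : caratheodory_measurable ((tuple_lebesgue n)^*)%mu B.
  by apply: sub_caratheodory; exact: sub_sigma_algebra.
move=> X; have := cB (onb_coord @` (X : set H)).
have [g gK Kg] := onb_coord_bij.
have img (D : set (n.-tuple RB)) : onb_coord @` (X : set H) `&` D =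
    onb_coord @` ((X : set H) `&` onb_coord @^-1` D).
  apply/seteqP; split => [_ [[x Xx <-] Dx]|_ [x [Xx Dx] <-]]; first by exists x.
  by split => //; exists x.
by rewrite !img preimage_setC.
Qed.

Lemma hilbert_lebesgue_preimage (B : set (n.-tuple RB)) : measurable B ->
  hilbert_lebesgue H (onb_coord @^-1` B) = tuple_lebesgue n B.
Proof.
move=> mB; rewrite -(measurable_mu_extE _ mB); congr (((tuple_lebesgue n)^*)%mu _).
have [g gK Kg] := onb_coord_bij.
by rewrite image_preimage//; apply/seteqP; split => // t _; exists (g t).
Qed.

Lemma integral_coord_row (F : 'rV[R]_n -> \bar R) : measurable_row F ->
  (forall v, 0 <= F v) ->
  \int[hilbert_lebesgue H]_y F (coord_row y) = lint F.
Proof.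
move=> mF F0.
have := ge0_integral_pushforward measurable_onb_coord (hilbert_lebesgue H)
  measurableT mF (fun x _ => F0 _).
rewrite preimage_setT /lint => <-.
apply: eq_measure_integral; first exact: measurable_onb_coord.
by move=> mphi B mB _; exact: (hilbert_lebesgue_preimage mB).
Qed.

End Coordinates.

(** * Borel majorants of Lebesgue measurable functions *)

Section Majorant.

(** Intersect the unions of countable covers whose excess tends to zero; when the outer measure is
    infinite, the whole space will do. *)
Lemma mu_ext_majorant d (T : measurableType d) (R : realType)
    (mu : {measure set T -> \bar R}) (X : set T) :
  exists B, [/\ measurable B, X `<=` B & mu B <= (mu^*)%mu X].
Proof.
have [->|Xoo] := eqVneq ((mu^*)%mu X) +oo.
  by exists setT; split => //; rewrite leey.
have X0 : 0 <= (mu^*)%mu X by exact: outer_measure_ge0.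
have Xfin : (mu^*)%mu X \is a fin_num by rewrite ge0_fin_numE// ltey.
have cov k : exists A : set T, [/\ measurable A, X `<=` A &
    mu A <= (mu^*)%mu X + (k.+1%:R^-1)%:E].
  have [|_ [A [mA XA] <-] muA] := @lb_ereal_inf_adherent _
    [set \sum_(k <oo) mu (A k) | A in measurable_cover X] (k.+1%:R^-1)%R _ Xfin.
    by rewrite invr_gt0.
  exists (\bigcup_i A i); split => //; first exact: bigcupT_measurable.
  rewrite (le_trans _ (ltW muA))//.
  by apply: measure_sigma_subadditive => //; exact: bigcupT_measurable.
have {cov}[A Ap] := choice cov.
exists (\bigcap_k A k); split.
- by apply: bigcapT_measurable => k; have [] := Ap k.
- by move=> x Xx k _; have [_ XA _] := Ap k; exact: XA.
apply/lee_addgt0Pr => e e0.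
have [k ke] : exists k : nat, (k.+1%:R^-1 <= e)%R.
  exists (Num.truncn e^-1); rewrite -[leRHS]invrK lef_pV2 ?posrE ?invr_gt0//.
  by rewrite ltW// truncnS_gt.
have [mA _ muA] := Ap k.
apply: (@le_trans _ _ (mu (A k))).
  apply: le_measure; rewrite ?inE//; last by move=> x; apply.
  by apply: bigcapT_measurable => i; have [] := Ap i.
by rewrite (le_trans muA)// leeD2l// lee_fin.
Qed.

Context {R : realType} (H : hilbertType R).
Local Notation n := (\dim {:H}).
Local Notation RB := (measurableTypeR R).

Import HBNNSimple.

Lemma nnsfun_majorant (h : {nnsfun lebesgueType H >-> R}) :
  exists F : 'rV[R]_n -> \bar R, [/\ measurable_row F, forall v, 0 <= F v,
    forall y : H, (h y)%:E <= F (coord_row y) &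
    lint F <= sintegral (hilbert_lebesgue H) h].
Proof.
have maj (r : R) := mu_ext_majorant (tuple_lebesgue n)
  (onb_coord @` (h @^-1` [set r] : set H)).
have [B Bp] := choice maj.
(* Each level set is replaced by a Borel superset of the same measure. The absolute value agrees
   with [r] on the range of [h] and keeps every term nonnegative for arbitrary [r]. *)
pose F (v : 'rV[R]_n) : \bar R :=
  \sum_(r \in range h) (`|r|%:E * (\1_(B r) (tuple_of_row v))%:E).
have Fn0 r y : 0 <= `|r|%:E * (\1_(B r) y)%:E by rewrite mule_ge0 ?lee_fin.
have FE v : F (row_of v) = \sum_(r \in range h) (`|r|%:E * (\1_(B r) v)%:E).
  by rewrite /F row_ofK.
exists F; split.
- rewrite /measurable_row; under eq_fun do rewrite FE.
  apply: emeasurable_fsum => // r.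
  apply/measurable_funeM/measurable_EFinP; apply: measurable_indic.
  by have [] := Bp r.
- by move=> v; apply: fsume_ge0 => r _; exact: Fn0.
- move=> y; rewrite /F (fsbigD1 (h y))//=; last by exists y.
  rewrite ger0_norm// indicE mem_set ?mule1; last first.
    have [_ + _] := Bp (h y); apply; exists y => //.
    by rewrite /coord_row row_ofK.
  by rewrite leeDl// fsume_ge0// => r _; exact: Fn0.
rewrite /lint; under eq_integral do rewrite FE.
rewrite ge0_integral_fsum//; last first.
  move=> r; apply/measurable_funeM/measurable_EFinP; apply: measurable_indic.
  by have [] := Bp r.
rewrite sintegralE; apply: lee_fsum => // r [z _ <-].
have [mB _ muB] := Bp (h z).
rewrite ge0_integralZl//; last exact/measurable_EFinP/measurable_indic.
by rewrite integral_indic// setIT ger0_norm// lee_wpmul2l// lee_fin.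
Qed.

End Majorant.

Section LebesgueMajorant.
Context {R : realType} (H : hilbertType R).
Local Notation n := (\dim {:H}).
Local Notation RB := (measurableTypeR R).

Import HBNNSimple.

(* Majorants by Borel functions spare us the Lebesgue measurability of the
   compositions [f j \o l j]. *)
Lemma lebesgue_majorant (f : lebesgueType H -> \bar R) :
  measurable_fun setT f -> (forall y, 0 <= f y) ->
  exists F : 'rV[R]_n -> \bar R, [/\ measurable_row F, forall v, 0 <= F v,
    forall y : H, f y <= F (coord_row y) &
    lint F <= \int[hilbert_lebesgue H]_y f y].
Proof.
move=> mf f0; pose h := nnsfun_approx measurableT mf.
have [F Fp] := choice (fun k => nnsfun_majorant (h k)).
have F0 k v : 0 <= F k v by have [] := Fp k.
have mF k : measurable_row (F k) by have [] := Fp k.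
(* The majorants [F k] need not converge. Their lower limit still dominates [f], and Fatou's lemma
   bounds its integral. *)
pose G v := limn_einf (F ^~ v).
have einfs0 v k : 0 <= einfs (F ^~ v) k.
  by apply: le_ereal_inf_tmp => _ [i _ <-].
exists G; split.
- apply: (emeasurable_fun_cvg (fun k x => einfs (F ^~ (row_of x)) k)).
    by move=> k; exact: measurable_fun_einfs.
  by move=> x _; rewrite /G limn_einf_lim; exact: is_cvg_einfs.
- move=> v; rewrite /G limn_einf_lim; apply: lime_ge; first exact: is_cvg_einfs.
  exact: nearW.
- move=> y; have hf := cvg_nnsfun_approx measurableT mf (fun x _ => f0 x) (x := y) I.
  have <- : limn_einf (fun k => (h k y)%:E) = f y.
    by have [] := cvg_limn_einf_sup hf.
  rewrite /G !limn_einf_lim; apply: lee_lim; try exact: is_cvg_einfs.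
  apply: nearW => k; apply: le_ereal_inf_tmp => _ [i /= ki <-].
  apply: (@le_trans _ _ (h i y)%:E); first by apply: ereal_inf_lbound; exists i.
  by have [_ _ + _] := Fp i; apply.
apply: le_trans (fatou _ measurableT mF (fun k v _ => F0 k _)) _.
rewrite limn_einf_lim; apply: lime_le; first exact: is_cvg_einfs.
apply: nearW => k; apply: (@le_trans _ _ (lint (F k))).
  by apply: ereal_inf_lbound; exists k => /=.
have [_ _ _ /le_trans] := Fp k; apply.
rewrite ge0_integralTE//; apply: ereal_sup_ubound; exists (h k) => //= y.
by rewrite nnsfun_approxE; exact: le_approx.
Qed.

End LebesgueMajorant.

Section InverseExponent.
Context {R : realType}.

Lemma inve_ge1_fin (p : \bar R) : 1 <= p -> p^-1 = (fine p^-1)%:E.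
Proof.
case: p => [r| |]//=; rewrite lee_fin => r1.
by rewrite inver gt_eqF// (lt_le_trans ltr01).
Qed.

Lemma fine_inve_ge0 (p : \bar R) : 1 <= p -> (0 <= fine p^-1)%R.
Proof. by move=> p1; rewrite fine_ge0// inve_ge0 (le_trans _ p1). Qed.

End InverseExponent.

(** * Norms of indicators, and majorants normalised by the norm *)

Section Lnorm.
Context {R : realType} (H : hilbertType R).
Local Notation n := (\dim {:H}).
Local Notation RB := (measurableTypeR R).

Lemma measurable_coord_row (F : 'rV[R]_n -> \bar R) : measurable_row F ->
  measurable_fun setT (fun y : lebesgueType H => F (coord_row y)).
Proof.
rewrite /measurable_row => mF.
have mc := @measurable_onb_coord R H.
exact: (measurableT_comp mF mc).
Qed.

Lemma Lnorm_indicator (p : \bar R) (b : 'rV[R]_n -> bool) : 1 <= p ->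
  measurable_row (fun v => (b v)%:R%:E) ->
  0 < lint (fun v => (b v)%:R%:E : \bar R) ->
  Lnorm (hilbert_lebesgue H) p (fun y => (b (coord_row y))%:R%:E) =
  lint (fun v => (b v)%:R%:E) `^ fine p^-1.
Proof.
move=> p1 mb lb; have b0 v : 0 <= (b v)%:R%:E :> \bar R by rewrite lee_fin.
rewrite unlock; case: p p1 => [r| |]// p1.
  have r0 : (0 < r)%R by rewrite (lt_le_trans ltr01).
  rewrite inver gt_eqF// [fine _]/=; congr (_ `^ _).
  rewrite -(integral_coord_row mb b0).
  apply: eq_integral => y _.
  by case: (b _); rewrite /= ?normr1 ?normr0 ?powR1 ?powR0 ?gt_eqF.
rewrite invey [fine _]/= poweRe0.
pose f (y : lebesgueType H) : \bar R := (b (coord_row y))%:R%:E.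
have mf : measurable_fun setT f by exact: (measurable_coord_row mb).
have lf : \int[hilbert_lebesgue H]_y f y = lint (fun v => (b v)%:R%:E).
  exact: (integral_coord_row mb b0).
(* The norm for [p = +oo] is the essential supremum only on a space of positive measure, and 0
   otherwise. *)
have mu0 : 0 < hilbert_lebesgue H setT.
  rewrite lt0e measure_ge0 andbT; apply/eqP => mu0.
  move: lb; rewrite -lf (@ge0_ae_eq_integral _ _ _ _ setT f (cst 0))//.
  - by rewrite integral0 ltxx.
  - by move=> x _; exact: b0.
  - exact: ae_eq0.
rewrite mu0; apply/eqP; rewrite eq_le; apply/andP; split.
  apply/ess_supP; apply: nearW => y /=; rewrite /f lee_fin.
  by case: (b _); rewrite /= ?normr1 ?normr0.
rewrite leNgt; apply/negP => s1.
have : \int[hilbert_lebesgue H]_y f y = 0.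
  rewrite (@ge0_ae_eq_integral _ _ _ _ setT f (cst 0))//.
  - by rewrite integral0.
  - by move=> x _; exact: b0.
  have := @ess_sup_ge _ _ _ (hilbert_lebesgue H) (abse \o f).
  apply: filterS => y /= fy _; move: (le_lt_trans fy s1); rewrite /f.
  by case: (b _); rewrite /= ?normr1 ?ltxx.
by move=> f0; move: lb; rewrite -lf f0 ltxx.
Qed.

(* For [p = +oo], [g = 0] (whose power [0 `^ 0] is [1]) and [D] is [+oo] on a
   null set off which [f] is at most its essential supremum. *)
Lemma Lnorm_majorant (p : \bar R) (f : lebesgueType H -> \bar R) : 1 <= p ->
  measurable_fun setT f -> (forall y, 0 <= f y) ->
  0 < Lnorm (hilbert_lebesgue H) p f < +oo ->
  exists g D : 'rV[R]_n -> \bar R,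
    [/\ measurable_row g /\ measurable_row D, forall v, 0 <= g v,
      lint g <= 1, (forall v, D v = 0 \/ D v = +oo) /\ lint D = 0 &
      forall y : H, f y <= Lnorm (hilbert_lebesgue H) p f *
        (g (coord_row y) `^ fine p^-1) + D (coord_row y)].
Proof.
move=> p1 mf f0 /andP[N0 Noo].
case: p p1 N0 Noo => [r| |]//.
  rewrite lee_fin => r1 N0 Noo; have r0 : (0 < r)%R by rewrite (lt_le_trans ltr01).
  move NE : (Lnorm _ _ f) N0 Noo => N N0 Noo.
  case: N N0 Noo NE => // nu; rewrite lte_fin => nu0 _ NE.
  (* Normalisation: [c] times the [r]-th power of [f] has integral 1, and [nu] times its [r]-th root
     gives [f] back. *)
  pose c := (nu `^ (- r))%R; have c0 : (0 < c)%R by rewrite powR_gt0.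
  have mfr : measurable_fun setT (fun y => f y `^ r).
    exact: measurableT_comp (measurable_poweR _) mf.
  have ifr : \int[hilbert_lebesgue H]_y (f y `^ r) = (nu `^ r)%:E.
    have := @poweR_Lnorm _ _ _ (hilbert_lebesgue H) f r; rewrite NE gt_eqF// => /(_ isT).
    rewrite poweR_EFin => ->; apply: eq_integral => y _.
    by rewrite gee0_abs.
  have mh : measurable_fun setT (fun y => c%:E * f y `^ r) by exact: measurable_funeM.
  have h0 y : 0 <= c%:E * f y `^ r by rewrite mule_ge0 ?poweR_ge0// lee_fin ltW.
  have [g [mg g0 fg lg]] := lebesgue_majorant mh h0.
  exists g, (fun=> 0); split => //.
  - by split => //; exact: measurable_cst.
  - apply: (le_trans lg); rewrite ge0_integralZl//; last 2 first.
    + by move=> y _; exact: poweR_ge0.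
    + by rewrite lee_fin ltW.
    rewrite ifr -EFinM lee_fin /c -powRD ?addNr ?powRr0//.
    by apply/implyP => _; rewrite gt_eqF.
  - by split; [left|rewrite /lint integral0].
  - move=> y; rewrite adde0 inver gt_eqF//=.
    apply: (@le_trans _ _ (nu%:E * ((c%:E * f y `^ r) `^ r^-1))).
      rewrite poweRM ?poweR_ge0 ?lee_fin ?(ltW c0)// -poweRrM mulfV ?gt_eqF//.
      rewrite poweRe1// poweR_EFin muleA -EFinM /c -powRrM mulNr mulfV ?gt_eqF//.
      by rewrite powR_inv1 ?(ltW nu0)// mulfV ?mul1e// gt_eqF.
    by rewrite lee_wpmul2l ?lee_fin ?(ltW nu0)// le_poweR ?invr_ge0 ?(ltW r0).
move=> _; rewrite unlock; case: ifPn => [mu0|_]; last by rewrite ltxx.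
set N := ess_sup _ _ => N0 Noo.
have [A [mA muA NA]] := @ess_sup_ge _ _ _ (hilbert_lebesgue H) (abse \o f).
have mI : measurable_fun setT (fun y : lebesgueType H => (\1_A y)%:E : \bar R).
  exact/measurable_EFinP/measurable_indic.
have I0 (y : lebesgueType H) : 0 <= (\1_A y)%:E :> \bar R by rewrite lee_fin.
have [D [mD D0 AD lD]] := lebesgue_majorant mI I0.
have {}lD : lint D = 0.
  apply/eqP; rewrite eq_le lint_ge0// andbT.
  by have := lD; rewrite integral_indic// setIT muA.
exists (fun=> 0), (fun v => +oo * D v); split => //.
- by split; [exact: measurable_cst|exact: measurable_funeM].
- by rewrite /lint integral0.
- split; last by rewrite lintZl// lD mule0.
  move=> v; have [->|Dv] := eqVneq (D v) 0; first by left; rewrite mule0.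
  by right; rewrite gt0_mulye// lt0e Dv D0.
- move=> y; rewrite invey [fine _]/= poweRe0 mule1.
  have [yA|yA] := pselect (A y).
    have Dy : 0 < D (coord_row y).
      rewrite (@lt_le_trans _ _ (\1_A y)%:E)//.
        by rewrite indicE mem_set// lte_fin.
    by rewrite gt0_mulye// addey ?leey// gt_eqF// (lt_trans _ N0)// ltNyr.
  rewrite (@le_trans _ _ N)//; last by rewrite leeDl// mule_ge0.
  rewrite -[f y]gee0_abs//; apply: contrapT => fyN; apply: yA; exact: NA.
Qed.

End Lnorm.

Section MatrixOfMap.
Context {R : realType} (H K : hilbertType R) (l : 'Hom(H, K)).
Local Open Scope ring_scope.

Definition onb_mx : 'M[R]_(\dim {:H}, \dim {:K}) := passmx.mxof (onb H) (onb K) l.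

Lemma coord_row_app (y : H) : coord_row (l y) = coord_row y *m onb_mx.
Proof. by rewrite !coord_rowE (passmx.rVof_app _ (onb_basis H)). Qed.

Lemma dim_limg_span k (X : k.-tuple H) : \dim (l @: <<X>>)%VS =
  \rank ((\matrix_(i < k) passmx.rVof (onb H) (tnth X i)) *m onb_mx).
Proof.
rewrite limg_span (dim_span_rVof (onb_basis K) [tuple of map l X]).
congr (\rank _); apply/row_matrixP => i; rewrite row_mul !rowK tnth_map.
by rewrite (passmx.rVof_app _ (onb_basis H)).
Qed.

Lemma onb_mx_section : limg l = fullv -> pinvmx onb_mx *m onb_mx = 1%:M.
Proof.
move=> lT; rewrite -[X in X *m _]mul1mx mulmxKpV// sub1mx.
have [eqT _] := andP (onb_basis H).
have := dim_limg_span (onb H); rewrite (eqP eqT) lT => kE.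
by rewrite /row_full eqn_leq rank_leq_col/= {1}kE mxrankM_maxr.
Qed.

End MatrixOfMap.

(** * Equivalence of the Hilbert space statement with its matrix form *)

Section Conditions.
Context {R : realType} (m : nat) (H : hilbertType R) (Hj : 'I_m -> hilbertType R).
Variables (l : forall j, 'Hom(H, Hj j)) (p : 'I_m -> \bar R).
Hypothesis p_ge1 : forall j, 1 <= p j.

Lemma sum_inve_dim (c : 'I_m -> nat) :
  \sum_j (p j)^-1 * (c j)%:R%:E = (\sum_j fine (p j)^-1 * (c j)%:R)%R%:E.
Proof.
rewrite -sumEFin; apply: eq_bigr => j _.
by rewrite {1}(inve_ge1_fin (p_ge1 j)).
Qed.

Lemma bl_condition_hilbert :
  bl_condition (fun j => onb_mx (l j)) (fun j => fine (p j)^-1) <->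
  ((\dim {:H})%:R%:E = \sum_(j < m) (p j)^-1 * (\dim {:Hj j})%:R%:E) /\
  (forall V : {vspace H},
     (\dim V)%:R%:E <= \sum_(j < m) (p j)^-1 * (\dim (l j @: V)%VS)%:R%:E).
Proof.
split=> [[dE cond]|[dE cond]]; split.
- by rewrite sum_inve_dim dE.
- move=> V; rewrite sum_inve_dim lee_fin.
  pose W := (\matrix_(i < \dim V) passmx.rVof (onb H) (tnth (vbasis V) i))%R.
  have := cond _ W; rewrite -(dim_span_rVof (onb_basis H)).
  under eq_bigr do rewrite -dim_limg_span.
  by rewrite (span_basis (vbasisP V)).
- by move: dE; rewrite sum_inve_dim => -[].
- move=> q W; pose X := [tuple passmx.vecof (onb H) (row i W) | i < q].
  have WE : (\matrix_(i < q) passmx.rVof (onb H) (tnth X i))%R = W.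
    apply/row_matrixP => i; rewrite rowK tnth_mktuple passmx.vecofK//.
    exact: onb_basis.
  have := cond <<X>>%VS; rewrite sum_inve_dim lee_fin.
  rewrite (dim_span_rVof (onb_basis H)) WE.
  by under eq_bigr do rewrite dim_limg_span WE.
Qed.

Hypothesis l_surj : forall j, limg (l j) = fullv.
Local Notation A := (fun j => onb_mx (l j)).
Local Notation t := (fun j => fine (p j)^-1).

(** Each [f j] is replaced by its Borel majorant from [Lnorm_majorant]. The matrix inequality
    applies to the [g j], whose integrals are at most 1, and surjectivity of [l j] makes the terms
    [D j] null on [H]. *)
Lemma bl_hilbert (C : R) : (0 <= C)%R ->
  (forall g : forall j, 'rV[R]_(\dim {:Hj j}) -> \bar R,
    (forall j, measurable_row (g j)) -> (forall j v, 0 <= g j v) ->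
    lint (fun x => \prod_j (g j (x *m A j) `^ t j)) <=
    C%:E * \prod_j (lint (g j) `^ t j)) ->
  forall f : forall j, lebesgueType (Hj j) -> \bar R,
  (forall j, [/\ measurable_fun setT (f j), forall x, 0 <= f j x,
     0 < Lnorm (hilbert_lebesgue (Hj j)) (p j) (f j) &
     Lnorm (hilbert_lebesgue (Hj j)) (p j) (f j) < +oo]) ->
  \int[hilbert_lebesgue H]_y \prod_(j < m) f j (l j y) <=
  C%:E * \prod_(j < m) Lnorm (hilbert_lebesgue (Hj j)) (p j) (f j).
Proof.
move=> C0 blC f fP; pose N j := Lnorm (hilbert_lebesgue (Hj j)) (p j) (f j).
have f0 j y : 0 <= f j y by have [] := fP j.
have N0 j : 0 <= N j by have [_ _ /ltW] := fP j.
have maj j : {gD : ('rV[R]_(\dim {:Hj j}) -> \bar R) * ('rV[R]_(\dim {:Hj j}) -> \bar R) |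
    [/\ measurable_row gD.1 /\ measurable_row gD.2, forall v, 0 <= gD.1 v,
      lint gD.1 <= 1, (forall v, gD.2 v = 0 \/ gD.2 v = +oo) /\ lint gD.2 = 0 &
      forall y : Hj j, f j y <= N j *
        (gD.1 (coord_row y) `^ fine (p j)^-1) + gD.2 (coord_row y)]}.
  apply: cid; have [mf f0' N0' Noo] := fP j.
  have [|g [D gD]] := Lnorm_majorant (p_ge1 j) mf f0'; first by apply/andP.
  by exists (g, D).
pose g j := (sval (maj j)).1; pose D j := (sval (maj j)).2.
have gDP j := svalP (maj j).
have mg j : measurable_row (g j) by have [[]] := gDP j.
have mD j : measurable_row (D j) by have [[]] := gDP j.
have g0 : forall j v, 0 <= g j v by move=> j; have [] := gDP j.
have Dv j v : D j v = 0 \/ D j v = +oo by have [_ _ _ [h _] _] := gDP j; exact: h.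
have D0 : forall j v, 0 <= D j v by move=> j v; case: (Dv j v) => ->.
have lD j : lint (D j) = 0 by have [_ _ _ [_ h] _] := gDP j.
pose F x := \prod_j N j * \prod_j (g j (x *m A j) `^ t j).
pose E x := \sum_j D j (x *m A j).
have F0 x : 0 <= F x.
  by rewrite mule_ge0 ?prode_ge0// => j _; exact: poweR_ge0.
have E0 x : 0 <= E x by exact: sume_ge0.
have mP := measurable_row_bl A t mg.
have mF : measurable_row F by exact: measurable_funeM.
have mE : measurable_row E.
  by apply: emeasurable_sum => j; exact: measurable_row_mulmx.
apply: (@le_trans _ _ (\int[hilbert_lebesgue H]_y (F (coord_row y) + E (coord_row y)))).
  apply: ge0_le_integral_nomeas => y; first exact: prode_ge0.
  have -> : E (coord_row y) = \sum_j D j (coord_row (l j y)).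
    by apply: eq_bigr => j _; rewrite coord_row_app.
  (* On the exceptional set the bound is infinite; off it every [D j] is zero and the factors
     compare one by one. *)
  have [[j Dj]|noD] := pselect (exists j, D j (coord_row (l j y)) = +oo).
    rewrite [X in _ + X](bigD1 j)//= Dj addye; last first.
      by rewrite gt_eqF// (lt_le_trans (ltNyr 0%R))// sume_ge0.
    by rewrite addey ?leey// gt_eqF// (lt_le_trans (ltNyr 0%R)).
  have Dz j : D j (coord_row (l j y)) = 0.
    by case: (Dv j (coord_row (l j y))) => // Doo; case: noD; exists j.
  rewrite [X in _ + X]big1// adde0 /F -big_split/=; apply: lee_prod => j _.
  rewrite f0/= -coord_row_app; have [_ _ _ _ /(_ (l j y))] := gDP j.
  by rewrite -/(D j) -/(g j) Dz adde0.
rewrite (integral_coord_row (F := fun x => F x + E x)); last 2 first.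
- exact: emeasurable_funD.
- by move=> x; exact: adde_ge0.
rewrite /lint ge0_integralD//.
rewrite [X in _ + X](_ : _ = 0) ?adde0; last first.
  rewrite /E ge0_integral_sum//; last by move=> j; exact: measurable_row_mulmx.
  apply: big1 => j _.
  exact: lint_mulmx_null (onb_mx_section (l_surj j)) (mD j) (D0 j) (lD j).
rewrite -/(lint F) lintZl//; last 2 first.
- by move=> v; exact: bl_ge0.
- exact: prode_ge0.
rewrite muleC lee_wpmul2r ?prode_ge0// (le_trans (blC g mg g0))//.
rewrite -[leRHS]mule1 lee_wpmul2l ?lee_fin//.
apply: (@le_trans _ _ (\prod_(j < m) (1 : \bar R))); last by rewrite big1.
apply: lee_prod => j _; rewrite poweR_ge0/= -[leRHS](poweR1r (fine (p j)^-1)).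
rewrite le_poweR ?fine_inve_ge0 ?lint_ge0//.
by have [] := gDP j.
Qed.

Lemma bl_hilbert_indicator (C : R) :
  (forall f : forall j, lebesgueType (Hj j) -> \bar R,
    (forall j, [/\ measurable_fun setT (f j), forall x, 0 <= f j x,
       0 < Lnorm (hilbert_lebesgue (Hj j)) (p j) (f j) &
       Lnorm (hilbert_lebesgue (Hj j)) (p j) (f j) < +oo]) ->
    \int[hilbert_lebesgue H]_y \prod_(j < m) f j (l j y) <=
    C%:E * \prod_(j < m) Lnorm (hilbert_lebesgue (Hj j)) (p j) (f j)) ->
  forall b : forall j, 'rV[R]_(\dim {:Hj j}) -> bool,
  (forall j, measurable_row (fun v => (b j v)%:R%:E)) ->
  (forall j, 0 < lint (fun v => (b j v)%:R%:E : \bar R) < +oo) ->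
  lint (fun x => \prod_j (b j (x *m A j))%:R%:E) <=
  C%:E * \prod_j (lint (fun v => (b j v)%:R%:E) `^ t j).
Proof.
move=> h b mb lb.
pose f j (y : lebesgueType (Hj j)) : \bar R := (b j (coord_row y))%:R%:E.
have fN j : Lnorm (hilbert_lebesgue (Hj j)) (p j) (f j) =
    lint (fun v => (b j v)%:R%:E) `^ fine (p j)^-1.
  by have /andP[lb0 _] := lb j; exact: Lnorm_indicator.
have {h} := h f; under eq_bigr do rewrite fN.
move=> h; rewrite -integral_coord_row; last 2 first.
- have := measurable_row_bl A (fun=> 1%R) mb; congr measurable_row.
  by apply/funext => x; apply: eq_bigr => j _; rewrite poweRe1 ?lee_fin.
- by move=> v; apply: prode_ge0 => j _; rewrite lee_fin.
apply: le_trans (h _).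
- apply: ge0_le_integral_nomeas => y; first by apply: prode_ge0 => j _; rewrite lee_fin.
  rewrite le_eqVlt; apply/orP; left; apply/eqP; apply: eq_bigr => j _.
  by rewrite /f coord_row_app.
- move=> j; have /andP[lb0 lboo] := lb j; rewrite fN; split.
  + exact: (measurable_coord_row (mb j)).
  + by move=> x; rewrite lee_fin.
  + exact: poweR_gt0.
  + exact: poweR_lty.
Qed.

End Conditions.

Theorem theorem2p1 (R : realType) (m : nat) (m_ge1 : (1 <= m)%N)
    (H : hilbertType R) (Hj : 'I_m -> hilbertType R)
    (dimH_gt0 : (0 < \dim {:H})%N)
    (dimHj_gt0 : forall j, (0 < \dim {:Hj j})%N)
    (l : forall j, 'Hom(H, Hj j))
    (l_surj : forall j, limg (l j) = fullv)
    (p : 'I_m -> \bar R) (p_ge1 : forall j, 1 <= p j) :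
  ereal_sup [set (\int[hilbert_lebesgue H]_y \prod_(j < m) f j (l j y)) /
                 \prod_(j < m) Lnorm (hilbert_lebesgue (Hj j)) (p j) (f j)
            | f in [set f : forall j, lebesgueType (Hj j) -> \bar R |
                forall j, [/\ measurable_fun setT (f j),
                              forall x, 0 <= f j x,
                              0 < Lnorm (hilbert_lebesgue (Hj j)) (p j) (f j)
                            & Lnorm (hilbert_lebesgue (Hj j)) (p j) (f j)
                                < +oo]]] < +oo
  <->
  ((\dim {:H})%:R%:E = \sum_(j < m) (p j)^-1 * (\dim {:Hj j})%:R%:E) /\
  (forall V : {vspace H},
     (\dim V)%:R%:E <= \sum_(j < m) (p j)^-1 * (\dim (l j @: V)%VS)%:R%:E).
Proof.
rewrite -(bl_condition_hilbert _ p_ge1); set S := [set _ | _ in _].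
(* A positive real denominator lets the extended quotient be cleared as in the reals. *)
have prodN (f : forall j, lebesgueType (Hj j) -> \bar R) :
    (forall j, [/\ measurable_fun setT (f j), forall x, 0 <= f j x,
       0 < Lnorm (hilbert_lebesgue (Hj j)) (p j) (f j) &
       Lnorm (hilbert_lebesgue (Hj j)) (p j) (f j) < +oo]) ->
    exists2 c : R, (0 < c)%R &
      \prod_(j < m) Lnorm (hilbert_lebesgue (Hj j)) (p j) (f j) = c%:E.
  move=> fP; pose c j := fine (Lnorm (hilbert_lebesgue (Hj j)) (p j) (f j)).
  exists (\prod_j c j)%R.
    by apply: prodr_gt0 => j _; have [_ _ N0 Noo] := fP j; rewrite fine_gt0// N0.
  rewrite -prode_EFin; apply: eq_bigr => j _; have [_ _ N0 Noo] := fP j.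
  by rewrite fineK// ge0_fin_numE// ltW.
split => [Soo|cond].
  (* The maximum with 0 excludes the value [-oo], so that [C] is a genuine real bound. *)
  pose C := fine (maxe (ereal_sup S) 0).
  have CE : maxe (ereal_sup S) 0 = C%:E.
    by rewrite fineK// ge0_fin_numE ?le_max ?lexx ?orbT// gt_max Soo ltry.
  apply: (@bl_necessary _ _ _ _ _ _ C).
  apply: (bl_hilbert_indicator p_ge1) => f fP.
  have [c c0 cE] := prodN f fP; rewrite cE -lee_pdivrMr//.
  rewrite -CE le_max; apply/orP; left; apply: ereal_sup_ubound.
  by exists f => //; rewrite cE inver gt_eqF.
have [|C C0 blC] := bl_sufficient dimH_gt0 _ cond.
  by move=> j; exact: fine_inve_ge0.
apply: (@le_lt_trans _ _ C%:E); last exact: ltry.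
apply: ge_ereal_sup => _ [f fP <-]; have [c c0 cE] := prodN f fP.
have := bl_hilbert p_ge1 l_surj C0 blC fP.
by rewrite cE inver gt_eqF// lee_pdivrMr.
Qed.
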